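(* Let $n,m\in\mathbb{N}$ and let $\varrho\in C^2(\mathbb{C};\mathbb{C})$ be neither holomorphic, nor antiholomorphic, nor $\mathbb{R}$-affine. Then $\mathcal{NN}^\varrho_{n,m,2n+2m+5}$ is universal. Moreover, if there is a point $z_0\in\mathbb{C}$ with either $\partial_{\mathrm{wirt}}\varrho(z_0)\neq0=\overline{\partial}_{\mathrm{wirt}}\varrho(z_0)$ or $\partial_{\mathrm{wirt}}\varrho(z_0)=0\neq\overline{\partial}_{\mathrm{wirt}}\varrho(z_0)$, then $\mathcal{NN}^\varrho_{n,m,n+m+4}$ is universal.
   Context: For $\varrho:\mathbb{C}\to\mathbb{C}$ and $n,m,W\in\mathbb{N}$, $\mathcal{NN}^\varrho_{n,m,W}$ denotes the set of all functions $\mathbb{C}^n\to\mathbb{C}^m$ of the form $V_L\circ\varrho^{\times W}\circ V_{L-1}\circ\cdots\circ\varrho^{\times W}\circ V_1$ with arbitrary depth $L\ge 2$, where $V_1:\mathbb{C}^n\to\mathbb{C}^W$, $V_2,\dots,V_{L-1}:\mathbb{C}^W\to\mathbb{C}^W$, $V_L:\mathbb{C}^W\to\mathbb{C}^m$ are $\mathbb{C}$-affine maps ($z\mapsto Az+b$ with complex $A,b$) and $\varrho^{\times W}$ applies $\varrho$ componentwise. A class $\mathcal{F}\subseteq C(\mathbb{C}^n;\mathbb{C}^m)$ is universal if for every $g\in C(\mathbb{C}^n;\mathbb{C}^m)$, compact $K\subseteq\mathbb{C}^n$ and $\varepsilon>0$ there is $f\in\mathcal{F}$ with $\sup_{z\in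 K}\|f(z)-g(z)\|<\varepsilon$. Wirtinger derivatives: $\partial_{\mathrm{wirt}}\varrho=\frac12(\partial_x\varrho-\mathrm{i}\partial_y\varrho)$, $\overline{\partial}_{\mathrm{wirt}}\varrho=\frac12(\partial_x\varrho+\mathrm{i}\partial_y\varrho)$. $\varrho$ is antiholomorphic if $\overline{\varrho}$ is holomorphic; $\varrho$ is $\mathbb{R}$-affine if it is affine as a map $\mathbb{R}^2\to\mathbb{R}^2$ under $\mathbb{C}\cong\mathbb{R}^2$. *)

(* Defs.v *)
(* MathComp-Analysis over an abstract realType R; C := R[i]. *)
From HB Require Import structures.
From mathcomp Require Import all_boot all_order all_algebra.
From mathcomp Require Import complex.
From mathcomp Require Import all_classical all_reals all_analysis.
Import Order.TTheory GRing.Theory Num.Theory.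
Import numFieldNormedType.Exports.

Unset Printing Implicit Defensive.

Local Open Scope ring_scope.
Local Open Scope classical_set_scope.
Local Open Scope complex_scope.

(* Equip the complex numbers R[i] with their standard (norm) topology and
   their structure of normed module over themselves. *)
HB.instance Definition _ (R : rcfType) := PseudoPointedMetric.copy R[i] (R[i])^o.
HB.instance Definition _ (R : rcfType) := NormedModule.copy R[i] (R[i])^o.

Section Defs.
Context {R : realType}.
Implicit Types (f : R[i] -> R[i]) (z l : R[i]).

(* real partial derivatives (C viewed as R^2 with z = x + i y) *)
Definition has_partial_x f z l : Prop :=
  (fun t : R => (f (z + t%:C) - f z) / t%:C) @ 0^' --> l.
Definition has_partial_y f z l : Prop :=
  (fun t : R => (f (z + 'i * t%:C) - f z) / t%:C) @ 0^' --> l.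

(* rho in C^2(C;C) in the real sense: all partial derivatives up to order 2
   exist everywhere and are continuous. *)
Definition C2 f : Prop :=
  exists fx fy fxx fxy fyx fyy : R[i] -> R[i],
    continuous f /\
    (forall z, has_partial_x f z (fx z)) /\
    (forall z, has_partial_y f z (fy z)) /\
    (forall z, has_partial_x fx z (fxx z)) /\
    (forall z, has_partial_y fx z (fxy z)) /\
    (forall z, has_partial_x fy z (fyx z)) /\
    (forall z, has_partial_y fy z (fyy z)) /\
    continuous fx /\ continuous fy /\
    continuous fxx /\ continuous fxy /\ continuous fyx /\ continuous fyy.

(* complex differentiable at every point *)
Definition holomorphic f : Prop := forall z, derivable f z 1.
Definition antiholomorphic f : Prop := holomorphic (fun z => (f z)^*).

(* affine as a map R^2 -> R^2 *)
Definition R_affine f : Prop :=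
  exists a11 a12 a21 a22 c1 c2 : R, forall x y : R,
    f (x +i* y) = (a11 * x + a12 * y + c1) +i* (a21 * x + a22 * y + c2).

(* Wirtinger derivatives from the partial derivatives dx = d_x rho, dy = d_y rho *)
Definition wirt (dx dy : R[i]) : R[i] := (dx - 'i * dy) / 2%:R.
Definition wirt_bar (dx dy : R[i]) : R[i] := (dx + 'i * dy) / 2%:R.

(* affine maps C^a -> C^b on row vectors: z |-> z A + c *)
Definition affmap {a b : nat} (A : 'M[R[i]]_(a, b)) (c : 'rV[R[i]]_b)
  (z : 'rV[R[i]]_a) : 'rV[R[i]]_b := z *m A + c.

(* componentwise activation *)
Definition actv (rho : R[i] -> R[i]) {W : nat} (z : 'rV[R[i]]_W) : 'rV[R[i]]_W :=
  map_mx rho z.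

(* NN^rho_{n,m,W}: V_L o rho o V_{L-1} o ... o rho o V_1, L >= 2,
   where hidden = [:: V_2; ...; V_{L-1}] (so L = size hidden + 2). *)
Definition NN (rho : R[i] -> R[i]) (n m W : nat) : set ('rV[R[i]]_n -> 'rV[R[i]]_m) :=
  [set f | exists (A1 : 'M[R[i]]_(n, W)) (b1 : 'rV[R[i]]_W)
                  (hidden : seq ('M[R[i]]_W * 'rV[R[i]]_W))
                  (AL : 'M[R[i]]_(W, m)) (bL : 'rV[R[i]]_m),
      f = fun z : 'rV[R[i]]_n => affmap AL bL
                     (actv rho (foldl (fun x V => affmap V.1 V.2 (actv rho x))
                                      (affmap A1 b1 z) hidden))].

(* universality in C(C^n; C^m), uniform approximation on compacta *)
Definition universal {n m : nat} (F : set ('rV[R[i]]_n -> 'rV[R[i]]_m)) : Prop :=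
  forall g : 'rV[R[i]]_n -> 'rV[R[i]]_m, continuous g ->
  forall K : set 'rV[R[i]]_n, compact K ->
  forall eps : R, 0 < eps ->
  exists2 f, F f & forall z : 'rV[R[i]]_n, K z -> `|f z - g z| < eps%:C.

End Defs.

(* Main.v *)
Require Import Defs.
From HB Require Import structures.
From mathcomp Require Import all_boot all_order all_algebra.
From mathcomp Require Import complex.
From mathcomp Require Import all_classical all_reals all_analysis.
From mathcomp Require Import ring lra zify.
Import Order.TTheory GRing.Theory Num.Theory.
Import numFieldNormedType.Exports.
Local Open Scope ring_scope.
Local Open Scope classical_set_scope.
Local Open Scope complex_scope.

(* A width-bounded network is run as a register machine: near a point where
   rho has a suitable nonzero Wirtinger derivative, one neuron (or a pair of
   neurons) reproduces a register to first order, so a layer can carry all the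
   registers and add one value [rho (affine form)] to a scratch register.
   Repeating this, every function in the closed span of the dilates and
   translates of rho can be added.  Differentiating [t |-> rho (z0 + t z)] once
   and twice at [0] shows that this span contains the conjugation and one of
   [z^2], [z * conj z], [(conj z)^2]; with polarization the machine multiplies
   by coordinates, hence evaluates all monomials in [z] and [conj z], sums them
   up in output registers, and Stone-Weierstrass concludes. *)

(** * The modulus on R[i] *)

(** The width may not depend on the accuracy, so the terms of a difference quotient or of a
    polynomial cannot sit side by side in one layer: they are executed one after another, and depth
    absorbs their number. This works because the affine form that is read does not see the scratch
    register that is written, so successive additions read the same value and add up. There are
    [k = n + m + 2] registers: input, output, one monomial, one scratch cell. At a point where only
    the nonvanishing of the holomorphic Wirtinger derivative is known, two neurons per register
    cancel the antilinear part, and [2 * k + 1 = 2 * n + 2 * m + 5]. Where exactly one Wirtinger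
    derivative vanishes, the differential is C-linear or antilinear and one neuron per register is
    enough; [k + 1] neurons then do the work and one more stays idle. In the antilinear case every
    layer conjugates all registers, so layers are used in pairs. Each hypothesis on [rho] yields one
    ingredient: not antiholomorphic gives the identity, not holomorphic gives the conjugation, not
    R-affine gives a quadratic form. *)

Local Notation nc := Normc.normc.

Section Modulus.
Context {R : realType}.
Implicit Types (z w l : R[i]) (x y : R).

Lemma normr_nc z : `|z| = (nc z)%:C.
Proof. by []. Qed.

Lemma nc_ge0 z : 0 <= nc z.
Proof. by rewrite -lecR -normr_nc normr_ge0. Qed.

Lemma ncD z w : nc (z + w) <= nc z + nc w.
Proof. by rewrite -lecR rmorphD -!normr_nc ler_normD. Qed.

Lemma ncN z : nc (- z) = nc z.
Proof. by apply: complexI; rewrite -!normr_nc normrN. Qed.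

Lemma ncBC z w : nc (z - w) = nc (w - z).
Proof. by rewrite -ncN opprB. Qed.

Lemma ncB z w : nc (z - w) <= nc z + nc w.
Proof. by rewrite -(ncN w) ncD. Qed.

Lemma nc_dist u z w : nc (z - w) <= nc (z - u) + nc (u - w).
Proof. by rewrite -[z - w](subrKA u) ncD. Qed.

Lemma ncM z w : nc (z * w) = nc z * nc w.
Proof. exact: Normc.normcM. Qed.

Lemma nc0 : nc (0 : R[i]) = 0.
Proof. exact: Normc.normc0. Qed.

Lemma ncR x : nc x%:C = `|x|.
Proof. by rewrite /= expr0n /= addr0 sqrtr_sqr. Qed.

Lemma nci : nc ('i%R : R[i]) = 1.
Proof. by rewrite -complexiE /= expr0n /= add0r expr1n sqrtr1. Qed.

Lemma ncJ z : nc z^*%C = nc z.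
Proof. by apply: complexI; rewrite -!normr_nc normcJ. Qed.

Lemma conjcD z w : (z + w)^*%C = z^*%C + w^*%C.
Proof. exact: rmorphD. Qed.

Lemma conjcN z : (- z)^*%C = - z^*%C.
Proof. exact: rmorphN. Qed.

Lemma conjcB z w : (z - w)^*%C = z^*%C - w^*%C.
Proof. exact: rmorphB. Qed.

Lemma conjcM z w : (z * w)^*%C = z^*%C * w^*%C.
Proof. exact: rmorphM. Qed.

Lemma conjci : ('i%R : R[i])^*%C = - 'i%R.
Proof. by rewrite -complexiE; apply/eqP; rewrite eq_complex /= oppr0 !eqxx. Qed.

Lemma nc_gt0 z : (0 < nc z) = (z != 0).
Proof. by rewrite -ltcR -normr_nc normr_gt0. Qed.

Lemma nc_eq0 z : (nc z == 0) = (z == 0).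
Proof. by rewrite -(inj_eq (@complexI _)) -normr_nc normr_eq0. Qed.

Lemma Re_le_nc z : `|complex.Re z| <= nc z.
Proof. by rewrite -lecR -normr_nc normc_ge_Re. Qed.

Lemma Im_le_nc z : `|complex.Im z| <= nc z.
Proof. by case: z => a b /=; rewrite -{1}sqrtr_sqr ler_wsqrtr// lerDr sqr_ge0. Qed.

Lemma nc_le_ReIm z : nc z <= `|complex.Re z| + `|complex.Im z|.
Proof.
rewrite {1}(complexE z) complexiE (le_trans (ncD _ _))// ncM nci mul1r !ncR.
exact: lexx.
Qed.

Lemma gt0_realC (e : R[i]) : 0 < e -> exists2 d : R, 0 < d & e = d%:C.
Proof.
case: e => a b; rewrite ltcE /= => /andP[/eqP -> a0].
by exists a.
Qed.

Lemma cvg_ncP {T : Type} {F : set_system T} {FF : Filter F} (f : T -> R[i]) l :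
  f @ F --> l <-> forall e : R, 0 < e -> \forall t \near F, nc (l - f t) < e.
Proof.
split=> [/cvgrPdist_lt fl e e0|fl].
  have := fl e%:C; rewrite ltcR => /(_ e0).
  by apply: filterS => t; rewrite normr_nc ltcR.
apply/cvgrPdist_lt => _ /gt0_realC[e e0 ->].
by apply: filterS (fl e e0) => t; rewrite normr_nc ltcR.
Qed.

Lemma nbhs_ncP (z : R[i]) (P : set R[i]) :
  nbhs z P <-> exists2 d : R, 0 < d & forall w, nc (w - z) < d -> P w.
Proof.
split.
  move/nbhs_normP => [_ /gt0_realC[d d0 ->] dP]; exists d => // w wd.
  by apply: dP => /=; rewrite normr_nc ltcR ncBC.
case=> d d0 dP; apply/nbhs_normP; exists d%:C => /=; first by rewrite ltcR.
by move=> w /=; rewrite normr_nc ltcR ncBC => /dP.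
Qed.

Lemma continuous_ncP {f : R[i] -> R[i]} : continuous f -> forall z (e : R), 0 < e ->
  exists2 d : R, 0 < d & forall w, nc (w - z) < d -> nc (f w - f z) < e.
Proof.
move=> fc z e e0; have /cvg_ncP/(_ e e0)/nbhs_ncP[d d0 dP] := fc z.
by exists d => // w /dP; rewrite ncBC.
Qed.

Lemma nc_continuous (f : R[i] -> R[i]) : (forall z (e : R), 0 < e ->
  exists2 d : R, 0 < d & forall w, nc (w - z) < d -> nc (f w - f z) < e) -> continuous f.
Proof.
move=> H z; apply/(@cvg_ncP _ (nbhs z)) => e /(H z)[d d0 dP].
by apply/nbhs_ncP; exists d => // w /dP; rewrite ncBC.
Qed.

Lemma dnbhs0_ncP (u : R -> R[i]) l : u @ 0^' --> l ->
  forall e : R, 0 < e ->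
  exists2 d : R, 0 < d & forall t, t != 0 -> `|t| < d -> nc (u t - l) < e.
Proof.
move=> /cvg_ncP ul e e0; have /nbhs_normP[d /= d0 dP] := ul e e0.
exists d => // t t0 td; rewrite ncBC.
by apply: dP => //=; rewrite sub0r normrN.
Qed.

End Modulus.

(** * First-order real differentiation *)

Section RealDifferentiation.
Context {R : realType}.
Implicit Types (f : R[i] -> R[i]) (z w v : R[i]) (u : R -> R[i]) (s t h e : R).

(** Differentiability of a complex-valued function of a real variable, in increment form: without a
    quotient, [t = 0] needs no exclusion. *)
Definition rderiv u s (l : R[i]) := forall e, 0 < e ->
  exists2 d, 0 < d & forall t, `|t| < d ->
    nc (u (s + t) - u s - t%:C * l) <= e * `|t|.

Lemma rderiv_diffquot u s l :
  (fun t => (u (s + t) - u s) / t%:C) @ 0^' --> l -> rderiv u s l.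
Proof.
move=> /dnbhs0_ncP ul e e0; have [d d0 dP] := ul e e0.
exists d => // t td; have [->|t0] := eqVneq t 0.
  by rewrite addr0 subrr mul0r subr0 nc0 normr0 mulr0.
have tC0 : t%:C != 0 by rewrite (inj_eq (@complexI R)).
rewrite -ncR -[X in X - _](divfK tC0) [_ / _ * _]mulrC -mulrBr ncM mulrC.
by rewrite ler_wpM2r ?nc_ge0// ltW ?dP.
Qed.

Lemma rderivD u1 u2 s l1 l2 : rderiv u1 s l1 -> rderiv u2 s l2 ->
  rderiv (fun t => u1 t + u2 t) s (l1 + l2).
Proof.
move=> h1 h2 e e0; have e20 : 0 < e / 2 by lra.
have [d1 d10 dP1] := h1 _ e20; have [d2 d20 dP2] := h2 _ e20.
exists (Num.min d1 d2); first by rewrite lt_min d10.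
move=> t; rewrite lt_min => /andP[/dP1 t1 /dP2 t2].
set x1 := u1 _ - _ - _ in t1; set x2 := u2 _ - _ - _ in t2.
rewrite (_ : _ - _ = x1 + x2); last by rewrite /x1 /x2; ring.
by rewrite (le_trans (ncD _ _))//; lra.
Qed.

Lemma rderivZ u s l (c : R[i]) : rderiv u s l -> rderiv (fun t => c * u t) s (c * l).
Proof.
move=> hu e e0; have c1 : 0 < nc c + 1 by rewrite ltr_wpDl ?nc_ge0.
have [d d0 dP] := hu (e / (nc c + 1)) (divr_gt0 e0 c1).
exists d => // t /dP ut; set x := u _ - _ - _ in ut.
rewrite (_ : _ - _ = c * x); last by rewrite /x; ring.
rewrite ncM (le_trans (ler_wpM2l (nc_ge0 _) ut))//.
rewrite mulrA ler_wpM2r// mulrCA ler_piMr ?(ltW e0)//.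
by rewrite ler_pdivrMr// mul1r lerDl.
Qed.

Lemma rderiv_linear s (c : R[i]) : rderiv (fun t => t%:C * c) s c.
Proof.
move=> e e0; exists 1 => // t _.
rewrite (_ : _ - _ = 0); last by rewrite rmorphD /=; ring.
by rewrite nc0 mulr_ge0// ltW.
Qed.

Lemma rderiv_sqr s (c : R[i]) : rderiv (fun t => (t ^+ 2)%:C * c) s ((2 * s)%:C * c).
Proof.
move=> e e0; have c1 : 0 < nc c + 1 by rewrite ltr_wpDl ?nc_ge0.
exists (e / (nc c + 1)); first exact: divr_gt0.
move=> t td; rewrite (_ : _ - _ = (t * t)%:C * c); last first.
  by rewrite (_ : 2 * s = s + s); [|by ring]; rewrite !rmorphXn rmorphM !rmorphD /=; ring.
rewrite ncM ncR normrM mulrAC ler_wpM2r//.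
have : `|t| * (nc c + 1) <= e by rewrite -ler_pdivlMr// ltW.
by apply: le_trans; rewrite ler_wpM2l// lerDl.
Qed.

Lemma rderiv_Re u s l : rderiv u s l -> is_derive s 1 (fun t => complex.Re (u t)) (complex.Re l).
Proof.
move=> hu.
have cv : (fun h => h^-1 *: ((complex.Re (u (h *: (1 : R) + s))) - complex.Re (u s)))
    @ 0^' --> complex.Re l.
  apply/cvgrPdist_le => e e0; have [d d0 dP] := hu e e0.
  apply/nbhs_normP; exists d => //= t /=; rewrite sub0r normrN => td t0.
  have := dP t td; rewrite [_ *: (1 : R)]mulr1 [t + s]addrC => ute.
  have := le_trans (Re_le_nc _) ute.
  rewrite (_ : complex.Re (_ - _) = complex.Re (u (s + t)) - complex.Re (u s) - t * complex.Re l);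
    last by case: (u (s + t)) (u s) l {hu dP ute} => [a b] [c d'] [p q]/=; ring.
  move=> H; rewrite distrC -(ler_pM2r (x := `|t|)) ?normr_gt0// -normrM.
  suff -> : (t^-1 *: (complex.Re (u (s + t)) - complex.Re (u s)) - complex.Re l) * t =
     complex.Re (u (s + t)) - complex.Re (u s) - t * complex.Re l by [].
  by rewrite -[_ *: _]/(_ * _); field.
apply: DeriveDef; first by apply/cvg_ex; exists (complex.Re l).
exact: cvg_lim cv.
Qed.

Lemma rderiv_Im u s l : rderiv u s l -> is_derive s 1 (fun t => complex.Im (u t)) (complex.Im l).
Proof.
move=> /(rderivZ _ _ _ (- 'i)) /rderiv_Re.
have E z : complex.Re (- 'i * z) = complex.Im z by case: z => a b /=; ring.
by under eq_fun do rewrite E; rewrite E.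
Qed.

Lemma mean_value_bound (v v' : R -> R) h e :
  (forall s, `|s| <= `|h| -> is_derive s 1 v (v' s)) ->
  (forall s, `|s| <= `|h| -> `|v' s| <= e) -> `|v h - v 0| <= e * `|h|.
Proof.
move=> dv ve; have [h0|h0] := leP 0 h.
  have abs s : s \in `[0, h]%R -> `|s| <= `|h|.
    by rewrite in_itv /= => /andP[s0 sh]; rewrite !ger0_norm.
  have [||c /abs ch ->] := @MVT_segment R v v' 0 h h0.
  - by move=> x /subset_itv_oo_cc /abs /dv.
  - by apply: derivable_within_continuous => x /abs /dv [].
  by rewrite subr0 normrM ler_wpM2r// ve.
have abs s : s \in `[h, 0]%R -> `|s| <= `|h|.
  by rewrite in_itv /= => /andP[s0 sh]; rewrite !ler0_norm ?lerN2// ltW.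
have [||c /abs ch E] := @MVT_segment R v v' h 0 (ltW h0).
- by move=> x /subset_itv_oo_cc /abs /dv.
- by apply: derivable_within_continuous => x /abs /dv [].
by rewrite distrC E sub0r normrM normrN ler_wpM2r// ve.
Qed.

(** The mean value theorem fails for complex values, so it is applied to the real and imaginary
    parts separately; this costs the factor 2. *)
Lemma mean_value_bound_nc u (u' : R -> R[i]) h e :
  (forall s, `|s| <= `|h| -> rderiv u s (u' s)) ->
  (forall s, `|s| <= `|h| -> nc (u' s) <= e) -> nc (u h - u 0) <= 2 * e * `|h|.
Proof.
move=> du ue; rewrite (le_trans (nc_le_ReIm _))//.
have HR := mean_value_bound _ _ h e (fun s sh => rderiv_Re _ _ _ (du s sh))
  (fun s sh => le_trans (Re_le_nc _) (ue s sh)).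
have HI := mean_value_bound _ _ h e (fun s sh => rderiv_Im _ _ _ (du s sh))
  (fun s sh => le_trans (Im_le_nc _) (ue s sh)).
rewrite /= in HR HI.
have -> : complex.Re (u h - u 0) = complex.Re (u h) - complex.Re (u 0).
  by case: (u h) (u 0) => [a b] [c d].
have -> : complex.Im (u h - u 0) = complex.Im (u h) - complex.Im (u 0).
  by case: (u h) (u 0) => [a b] [c d].
by rewrite -mulrA mulr_natl mulr2n lerD.
Qed.

(** With [p] and [q] the partial derivatives at a point, this is the real differential there,
    applied to [v]. *)
Definition rlin (p q v : R[i]) : R[i] := p * (complex.Re v)%:C + q * (complex.Im v)%:C.

Lemma rlinE p q v : rlin p q v = wirt p q * v + wirt_bar p q * v^*%C.
Proof. by rewrite /rlin ReJ_add ImJ_sub /wirt /wirt_bar complexiE; field. Qed.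

Lemma rlinN p q v : rlin p q (- v) = - rlin p q v.
Proof. by rewrite !rlinE conjcN; ring. Qed.

Lemma rlinZ p q t v : rlin p q (t%:C * v) = t%:C * rlin p q v.
Proof. by case: v => a b; rewrite /rlin /= !mul0r subr0 addr0 !rmorphM /=; ring. Qed.

Lemma nc_rlin p q v : nc (rlin p q v) <= (nc p + nc q) * nc v.
Proof.
rewrite (le_trans (ncD _ _))// !ncM !ncR mulrDl.
by rewrite lerD// ler_wpM2l ?nc_ge0// ?Re_le_nc ?Im_le_nc.
Qed.

Definition c1 f (fx fy : R[i] -> R[i]) :=
  [/\ forall z, has_partial_x f z (fx z), forall z, has_partial_y f z (fy z),
      continuous fx & continuous fy].

Lemma c1_rderiv_x {f fx fy} : c1 f fx fy ->
  forall z s, rderiv (fun t => f (z + t%:C)) s (fx (z + s%:C)).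
Proof.
move=> [px _ _ _] z s; apply: rderiv_diffquot.
by under eq_fun do rewrite rmorphD addrA; exact: px.
Qed.

Lemma c1_rderiv_y {f fx fy} : c1 f fx fy ->
  forall z s, rderiv (fun t => f (z + 'i * t%:C)) s (fy (z + 'i * s%:C)).
Proof.
move=> [_ py _ _] z s; apply: rderiv_diffquot.
by under eq_fun do rewrite rmorphD mulrDr addrA; exact: py.
Qed.

(** Continuous partial derivatives give total differentiability: go from [z] to [z + w] first
    horizontally, then vertically, and bound [f] minus its linear part on each leg. *)
Lemma c1_increment {f fx fy} : c1 f fx fy -> forall z e, 0 < e ->
  exists2 d, 0 < d & forall w, nc w < d ->
    nc (f (z + w) - f z - rlin (fx z) (fy z) w) <= e * nc w.
Proof.
move=> fc z e e0; have e40 : 0 < e / 4 by lra.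
have [_ _ cx cy] := fc.
have [d1 d10 dP1] := continuous_ncP cx z _ e40.
have [d2 d20 dP2] := continuous_ncP cy z _ e40.
(* The points of the two legs are within [2 * nc w] of [z], hence the halving. *)
exists (Num.min d1 d2 / 2); first by rewrite divr_gt0// lt_min d10.
move=> w; rewrite ltr_pdivlMr// lt_min => /andP[w1 w2].
have := Re_le_nc w; have := Im_le_nc w.
move: (complexE w) w1 w2; rewrite complexiE; set x := complex.Re w; set y := complex.Im w.
move=> wE w1 w2 yw xw.
have xy s : `|s| <= `|y| -> nc (z + x%:C + 'i * s%:C - z) <= nc w * 2.
  move=> sy; rewrite addrAC [z + _]addrC addrK (le_trans (ncD _ _))//.
  by rewrite ncM nci mul1r !ncR; lra.
have xx s : `|s| <= `|x| -> nc (z + s%:C - z) <= nc w * 2.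
  by move=> sx; rewrite [z + _]addrC addrK ncR; have := nc_ge0 w; lra.
have H1 : nc ((f (z + x%:C + 'i * y%:C) + y%:C * - fy z) -
           (f (z + x%:C + 'i * 0%:C) + 0%:C * - fy z)) <= 2 * (e / 4) * `|y|.
  apply: (mean_value_bound_nc (fun t => f (z + x%:C + 'i * t%:C) + t%:C * - fy z)
    (fun s => fy (z + x%:C + 'i * s%:C) - fy z)) => s sy.
    by apply: rderivD; [exact: (c1_rderiv_y fc)|exact: rderiv_linear].
  by apply/ltW/dP2/(le_lt_trans (xy s sy)).
have H2 : nc ((f (z + x%:C) + x%:C * - fx z) -
           (f (z + 0%:C) + 0%:C * - fx z)) <= 2 * (e / 4) * `|x|.
  apply: (mean_value_bound_nc (fun t => f (z + t%:C) + t%:C * - fx z)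
    (fun s => fx (z + s%:C) - fx z)) => s sy.
    by apply: rderivD; [exact: (c1_rderiv_x fc)|exact: rderiv_linear].
  by apply/ltW/dP1/(le_lt_trans (xx s sy)).
move: H1 H2; rewrite !mulr0 !mul0r !addr0 => H1 H2.
rewrite {1}wE addrA /rlin -/x -/y.
rewrite (_ : _ - _ = (f (z + x%:C + 'i * y%:C) + y%:C * - fy z - f (z + x%:C)) +
  (f (z + x%:C) + x%:C * - fx z - f z)); last by ring.
rewrite (le_trans (ncD _ _))//.
have : 2 * (e / 4) * `|y| <= e / 2 * nc w by rewrite ler_pM//; lra.
have : 2 * (e / 4) * `|x| <= e / 2 * nc w by rewrite ler_pM//; lra.
by lra.
Qed.

Lemma c1_rderiv_dir {f fx fy} : c1 f fx fy -> forall z v s,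
  rderiv (fun t => f (z + t%:C * v)) s (rlin (fx (z + s%:C * v)) (fy (z + s%:C * v)) v).
Proof.
move=> fc z v s e e0; have v1 : 0 < nc v + 1 by rewrite ltr_wpDl ?nc_ge0.
have [d d0 dP] := c1_increment fc (z + s%:C * v) _ (divr_gt0 e0 v1).
exists (d / (nc v + 1)); first exact: divr_gt0.
move=> t; rewrite ltr_pdivlMr// => td.
have tv : nc (t%:C * v) < d.
  by rewrite ncM ncR (le_lt_trans _ td)// ler_wpM2l// lerDl.
have E : z + (s + t)%:C * v = z + s%:C * v + t%:C * v by rewrite rmorphD /=; ring.
have := dP _ tv; rewrite E rlinZ => H.
rewrite (le_trans H)// ncM ncR.
rewrite [leLHS](_ : _ = nc v / (nc v + 1) * (e * `|t|)); last by field; rewrite gt_eqF.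
rewrite ler_piMl ?mulr_ge0 ?(ltW e0)//.
by rewrite ler_pdivrMr// mul1r lerDl.
Qed.

(** One [h] serves all [v] in a disc; this uniformity lets a single choice of weights work for all
    bounded states. *)
Lemma first_difference {f fx fy} : c1 f fx fy -> forall z (M : R) e, 0 < e ->
  exists2 h : R, h != 0 & forall v, nc v <= M ->
    nc ((f (z + h%:C * v) - f z) / h%:C - rlin (fx z) (fy z) v) < e.
Proof.
move=> fc z M e e0; pose N := `|M| + 1.
have N0 : 0 < N by rewrite ltr_wpDl.
have [d d0 dP] := c1_increment fc z _ (divr_gt0 e0 N0).
have h0 : 0 < d / N by exact: divr_gt0.
exists (d / N); first by rewrite gt_eqF.
move=> v vM; set h := d / N.
have hC0 : h%:C != 0 by rewrite (inj_eq (@complexI R)) gt_eqF.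
have vN : nc v < N by rewrite (le_lt_trans vM)// (le_lt_trans (ler_norm _))// ltrDl.
have hv : nc (h%:C * v) < d by rewrite ncM ncR ger0_norm ?ltW// mulrC -ltr_pdivlMr// /h invf_div mulrCA divff ?mulr1// gt_eqF.
have := dP _ hv; rewrite rlinZ => H.
rewrite -(ltr_pM2r h0) -[X in _ * X < _](gtr0_norm h0) -ncR -ncM mulrBl divfK// [_ * h%:C]mulrC.
rewrite (le_lt_trans H)// ncM ncR (gtr0_norm h0) mulrCA mulrC ltr_pM2r//.
by rewrite mulrAC ltr_pdivrMr// ltr_pM2l.
Qed.

End RealDifferentiation.

(** * Second-order behaviour and Wirtinger derivatives *)

Section SecondOrder.
Context {R : realType}.
Implicit Types (f : R[i] -> R[i]) (z w v : R[i]) (s t h e : R).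

(** With the second partial derivatives as coefficients, this is the Hessian form at [(v, v)]. *)
Definition quad (a b c d v : R[i]) : R[i] := rlin (rlin a b v) (rlin c d v) v.

Lemma quadE a b c d : exists A B C : R[i],
  forall v, quad a b c d v = A * (v * v) + B * (v * v^*%C) + C * (v^*%C * v^*%C).
Proof.
exists (wirt (wirt a b) (wirt c d)).
exists (wirt (wirt_bar a b) (wirt_bar c d) + wirt_bar (wirt a b) (wirt c d)).
exists (wirt_bar (wirt_bar a b) (wirt_bar c d)) => v.
by rewrite /quad !rlinE /wirt /wirt_bar; ring.
Qed.

(** The mean value bound is applied to [f (z + t v) + f (z - t v) - t^2 Q]. In its derivative the
    values of [fx] and [fy] at [z] cancel, and what remains is made of the first-order remainders of
    [fx] and [fy]. *)
Lemma second_difference f fx fy fxx fxy fyx fyy :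
  c1 f fx fy -> c1 fx fxx fxy -> c1 fy fyx fyy ->
  forall z (M : R) e, 0 < e -> exists2 h : R, h != 0 & forall v, nc v <= M ->
    nc ((f (z + h%:C * v) + f (z + h%:C * - v) - 2 * f z) / (h ^+ 2)%:C
        - quad (fxx z) (fxy z) (fyx z) (fyy z) v) < e.
Proof.
move=> cf cfx cfy z M e e0; pose N := `|M| + 1.
have N0 : 0 < N by rewrite ltr_wpDl.
(* The final bound is [2 * (4 * e' * h * N^2) * h], which this choice turns into [e / 2 * h^2]. *)
pose e' := e / (16 * N ^+ 2).
have e'0 : 0 < e' by rewrite divr_gt0// mulr_gt0// exprn_gt0.
have [d1 d10 dP1] := c1_increment cfx z _ e'0.
have [d2 d20 dP2] := c1_increment cfy z _ e'0.
pose d := Num.min d1 d2.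
have d0 : 0 < d by rewrite lt_min d10.
have h0 : 0 < d / N by exact: divr_gt0.
exists (d / N); first by rewrite gt_eqF.
move=> v vM; set h := d / N; set Q := quad _ _ _ _ _.
have hN : h * N = d by rewrite divfK// gt_eqF.
have vN : nc v < N by rewrite (le_lt_trans vM)// (le_lt_trans (ler_norm _))// ltrDl.
have h2C0 : (h ^+ 2)%:C != 0 by rewrite (inj_eq (@complexI R)) expf_neq0// gt_eqF.
have small s : `|s| <= `|h| -> nc (s%:C * v) < d.
  rewrite (gtr0_norm h0) => sh; rewrite ncM ncR -hN.
  by rewrite (le_lt_trans (ler_wpM2r (nc_ge0 _) sh))// ltr_pM2l.
have H : nc ((f (z + h%:C * v) + f (z + h%:C * - v) + (h ^+ 2)%:C * - Q) -
    (f (z + 0%:C * v) + f (z + 0%:C * - v) + (0 ^+ 2)%:C * - Q)) <=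
    2 * (4 * e' * h * N ^+ 2) * `|h|.
  apply: (mean_value_bound_nc (fun t => f (z + t%:C * v) + f (z + t%:C * - v) + (t ^+ 2)%:C * - Q)
   (fun s => rlin (fx (z + s%:C * v)) (fy (z + s%:C * v)) v +
     rlin (fx (z + s%:C * - v)) (fy (z + s%:C * - v)) (- v) + (2 * s)%:C * - Q)) => s sh.
    by apply: rderivD; [apply: rderivD; exact: c1_rderiv_dir|exact: rderiv_sqr].
  have sv := small s sh.
  have snv : nc (s%:C * - v) < d by rewrite mulrN ncN.
  have [sv1 sv2] : nc (s%:C * v) < d1 /\ nc (s%:C * v) < d2.
    by move: sv; rewrite lt_min => /andP.
  have [snv1 snv2] : nc (s%:C * - v) < d1 /\ nc (s%:C * - v) < d2.
    by move: snv; rewrite lt_min => /andP.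
  move: (dP1 _ sv1) (dP1 _ snv1) (dP2 _ sv2) (dP2 _ snv2).
  rewrite !rlinZ !rlinN.
  set x1 := _ - _ - _; set x2 := _ - _ - _; set y1 := _ - _ - _; set y2 := _ - _ - _.
  rewrite !mulrN !ncN => X1 X2 Y1 Y2.
  rewrite (_ : _ - _ = rlin (x1 - x2) (y1 - y2) v); last first.
    rewrite (_ : 2 * s = s + s); last by ring.
    by rewrite /Q /quad rmorphD /= /rlin /x1 /x2 /y1 /y2 /rlin !mulrN; ring.
  rewrite (le_trans (nc_rlin _ _ _))//.
  have b1 : nc (x1 - x2) + nc (y1 - y2) <= 4 * (e' * nc (s%:C * v)).
    by have := ncB x1 x2; have := ncB y1 y2; lra.
  rewrite (le_trans (ler_wpM2r (nc_ge0 _) b1))// ncM ncR.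
  rewrite [leLHS](_ : _ = (4 * e') * (`|s| * nc v ^+ 2)); last by ring.
  rewrite [leRHS](_ : _ = (4 * e') * (h * N ^+ 2)); last by ring.
  apply: (ler_wpM2l (mulr_ge0 (ler0n _ 4) (ltW e'0))).
  rewrite ler_pM ?sqr_ge0//; first by rewrite (le_trans sh)// gtr0_norm.
  by rewrite lerXn2r ?nnegrE ?nc_ge0 ?ltW.
move: H; rewrite !mul0r !addr0 expr0n /= mul0r addr0.
rewrite (_ : _ - _ = (f (z + h%:C * v) + f (z + h%:C * - v) - 2 * f z) - (h ^+ 2)%:C * Q);
  last by ring.
move=> H; have h20 : 0 < h ^+ 2 by rewrite exprn_gt0.
rewrite -(ltr_pM2r h20) -[X in _ * X < _](gtr0_norm h20) -ncR -ncM mulrBl divfK//.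
rewrite [Q * _]mulrC (le_lt_trans H)// (gtr0_norm h0) /e'.
rewrite (_ : 2 * _ * h = e / 2 * h ^+ 2); last by field; rewrite gt_eqF.
by rewrite ltr_pM2r//; lra.
Qed.

(** On a ray through 0 the directional derivative [p] has derivative [quad = 0], so it is constant,
    and then [f (t v) - t * p 0] is constant too. Both facts are the mean value bound with
    [e = 0]. *)
Lemma affine_of_quad0 f fx fy fxx fxy fyx fyy :
  c1 f fx fy -> c1 fx fxx fxy -> c1 fy fyx fyy ->
  (forall z v, quad (fxx z) (fxy z) (fyx z) (fyy z) v = 0) ->
  forall v, f v = f 0 + rlin (fx 0) (fy 0) v.
Proof.
move=> cf cfx cfy Q0 v.
pose p t := rlin (fx (0 + t%:C * v)) (fy (0 + t%:C * v)) v.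
have dp s : rderiv p s 0.
  rewrite -(Q0 (0 + s%:C * v) v).
  have := rderivD _ _ s _ _ (rderivZ _ s _ (complex.Re v)%:C (c1_rderiv_dir cfx 0 v s))
    (rderivZ _ s _ (complex.Im v)%:C (c1_rderiv_dir cfy 0 v s)).
  by congr rderiv; [apply/funext => t; rewrite /p /rlin; ring|rewrite /quad /rlin; ring].
have pE s : p s = p 0.
  apply/eqP; rewrite -subr_eq0 -nc_eq0 eq_le nc_ge0 andbT.
  have := @mean_value_bound_nc R p (fun=> 0) s 0.
  by rewrite mulr0 mul0r; apply => // *; rewrite nc0.
have := @mean_value_bound_nc R (fun t => f (0 + t%:C * v) + t%:C * - p 0)
  (fun s => p s - p 0) 1 0.
rewrite mulr0 mul0r => H.
have {}H : nc (f (0 + 1%:C * v) + 1%:C * - p 0 - (f (0 + 0%:C * v) + 0%:C * - p 0)) <= 0.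
  apply: H => s _; last by rewrite pE subrr nc0.
  by apply: rderivD; [exact: (c1_rderiv_dir cf)|exact: rderiv_linear].
have /eqP : nc (f (0 + 1%:C * v) + 1%:C * - p 0 - (f (0 + 0%:C * v) + 0%:C * - p 0)) == 0.
  by rewrite eq_le H nc_ge0.
move/eqP; rewrite nc_eq0 subr_eq0 /p !mul0r !mul1r !add0r !addr0 subr_eq.
by move/eqP.
Qed.

Lemma R_affine_rlin f p q : (forall v, f v = f 0 + rlin p q v) -> R_affine f.
Proof.
move=> fE; exists (complex.Re p), (complex.Re q), (complex.Im p), (complex.Im q).
exists (complex.Re (f 0)), (complex.Im (f 0)) => x y.
rewrite fE; case: p q (f 0) {fE} => [p1 p2] [q1 q2] [c1 c2].
by apply/eqP; rewrite eq_complex /=; apply/andP; split; apply/eqP; ring.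
Qed.

(** The Cauchy-Riemann criterion: the differential is then multiplication by the other Wirtinger
    derivative. *)
Lemma holomorphic_wirt_bar0 f fx fy : c1 f fx fy ->
  (forall z, wirt_bar (fx z) (fy z) = 0) -> holomorphic f.
Proof.
move=> cf w0 z; apply/cvg_ex; exists (wirt (fx z) (fy z)).
apply/cvg_ncP => e e0; have e20 : 0 < e / 2 by lra.
have [d d0 dP] := c1_increment cf z _ e20.
apply/nbhs_ncP; exists d => // h; rewrite subr0 => hd h0.
have := dP h hd; rewrite rlinE w0 mul0r addr0 => H.
rewrite ncBC /= -[h *: 1]/(h * 1) mulr1 [h + z]addrC -[_ *: _]/(_ * _).
have hp : 0 < nc h by rewrite nc_gt0.
rewrite -(ltr_pM2r hp) -ncM mulrBl mulrAC mulVf// mul1r (le_lt_trans H)//.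
by rewrite ltr_pM2r//; lra.
Qed.

Lemma has_partial_conj (u : R -> R[i]) (l : R[i]) :
  (fun t => u t / t%:C) @ 0^' --> l ->
  (fun t => (u t)^*%C / t%:C) @ 0^' --> l^*%C.
Proof.
move=> /cvg_ncP H; apply/cvg_ncP => e e0; apply: filterS (H e e0) => t.
by rewrite -ncJ conjcB conjcM conjc_inv conjc_real.
Qed.

Lemma c1_conj f fx fy : c1 f fx fy ->
  c1 (fun z => (f z)^*%C) (fun z => (fx z)^*%C) (fun z => (fy z)^*%C).
Proof.
move=> [px py cx cy].
have cJ (g : R[i] -> R[i]) : continuous g -> continuous (fun z => (g z)^*%C : R[i]).
  move=> gc; apply: nc_continuous => z e /(continuous_ncP gc z)[d d0 dP].
  by exists d => // w /dP; rewrite -ncJ conjcB.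
split; [move=> z; have := has_partial_conj _ _ (px z)
       |move=> z; have := has_partial_conj _ _ (py z)|exact: cJ|exact: cJ];
  by under eq_fun do rewrite conjcB.
Qed.

Lemma antiholomorphic_wirt0 f fx fy : c1 f fx fy ->
  (forall z, wirt (fx z) (fy z) = 0) -> antiholomorphic f.
Proof.
move=> /c1_conj cf w0; apply: holomorphic_wirt_bar0 cf _ => z.
have := congr1 (@conjc R) (w0 z); rewrite conjc0 => <-.
by rewrite /wirt /wirt_bar conjcM conjc_inv conjc_nat conjcB conjcM conjci mulNr opprK.
Qed.

Lemma C2_c1 f : C2 f -> exists fx fy fxx fxy fyx fyy,
  [/\ c1 f fx fy, c1 fx fxx fxy & c1 fy fyx fyy].
Proof.
case=> fx [fy [fxx [fxy [fyx [fyy [_ [h1 [h2 [h3 [h4 [h5 [h6 [h7 [h8 [h9 [h10 [h11 h12]]]]]]]]]]]]]]]]].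
by exists fx, fy, fxx, fxy, fyx, fyy; split; split.
Qed.

Lemma has_partial_unique (u : R -> R[i]) (l l' : R[i]) :
  u @ 0^' --> l -> u @ 0^' --> l' -> l = l'.
Proof. by move=> ul ul'; apply: cvg_unique ul ul'; exact: norm_hausdorff. Qed.

(** Abstract because it is used twice: for the functions that can be added to a register, and for
    those whose conjugate can. *)
Record closed_class (Phi : set (R[i] -> R[i])) : Prop := ClosedClass {
  class_add : forall f g, Phi f -> Phi g -> Phi (fun z => f z + g z);
  class_scale : forall (c : R[i]) f, Phi f -> Phi (fun z => c * f z);
  class_affine : forall (a b : R[i]) f, Phi f -> Phi (fun z => f (a * z + b));
  class_lim : forall f, (forall (M : R) e, 0 < e ->
    exists2 g, Phi g & forall z, nc z <= M -> nc (g z - f z) < e) -> Phi f }.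

Lemma class_rlin Phi f fx fy z : closed_class Phi -> c1 f fx fy -> Phi f ->
  Phi (rlin (fx z) (fy z)).
Proof.
move=> [cD cZ cA cL] cf Pf; apply: cL => M e e0.
have [h h0 hP] := first_difference cf z M _ e0.
(* The class is not assumed to contain constants; the constant [f z] is [f] precomposed with an
   affine map of slope 0. *)
exists (fun v => h%:C^-1 * f (h%:C * v + z) + (- h%:C^-1) * f (0 * v + z)).
  by apply: (cD (fun v => _) (fun v => _)); apply: (cZ _ (fun v => _)); exact: cA.
move=> v /hP; apply: le_lt_trans; rewrite le_eqVlt; apply/orP; left; apply/eqP.
by congr nc; rewrite mul0r add0r [z + _]addrC; ring.
Qed.

Lemma class_quad Phi f fx fy fxx fxy fyx fyy z : closed_class Phi ->
  c1 f fx fy -> c1 fx fxx fxy -> c1 fy fyx fyy -> Phi f ->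
  Phi (quad (fxx z) (fxy z) (fyx z) (fyy z)).
Proof.
move=> [cD cZ cA cL] cf cfx cfy Pf; apply: cL => M e e0.
have [h h0 hP] := second_difference _ _ _ _ _ _ _ cf cfx cfy z M _ e0.
exists (fun v => (h ^+ 2)%:C^-1 * f (h%:C * v + z) + ((h ^+ 2)%:C^-1 * f (- h%:C * v + z)
   + (- 2 * (h ^+ 2)%:C^-1) * f (0 * v + z))).
  apply: (cD (fun v => _) (fun v => _)); last apply: (cD (fun v => _) (fun v => _));
    by apply: (cZ _ (fun v => _)); exact: cA.
move=> v /hP; apply: le_lt_trans; rewrite le_eqVlt; apply/orP; left; apply/eqP.
by congr nc; rewrite mul0r add0r !mulrN !mulNr ![z + _]addrC; ring.
Qed.

Definition has_quadratic (Phi : set (R[i] -> R[i])) :=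
  [\/ Phi (fun z => z * z), Phi (fun z => z * z^*%C) | Phi (fun z => z^*%C * z^*%C)].

(* Replacing [v] by ['i v] and [(1 + 'i) v] and recombining isolates the
   components of type [v], [conj v], [v * conj v], [v^2] and [(conj v)^2]. *)
Lemma class_generators Phi f : closed_class Phi -> C2 f ->
  ~ holomorphic f -> ~ antiholomorphic f -> ~ R_affine f -> Phi f ->
  [/\ Phi id, Phi conjc & has_quadratic Phi].
Proof.
move=> PC /C2_c1[fx [fy [fxx [fxy [fyx [fyy [cf cfx cfy]]]]]]] nh na nr Pf.
have [cD cZ cA cL] := PC.
have i2 : 'i%R * 'i%R = -1 :> R[i] by rewrite -expr2 sqrCi.
split.
- have [z wz] : exists z, wirt (fx z) (fy z) != 0.
    apply: contrapT => H; apply: na; apply: (antiholomorphic_wirt0 _ _ _ cf) => z.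
    by apply/eqP; apply: contrapT => /negP wz; apply: H; exists z.
  have PL := class_rlin _ _ _ _ z PC cf Pf.
  have := cD _ _ (cZ (2 * wirt (fx z) (fy z))^-1 _ PL)
    (cZ (- 'i%R / (2 * wirt (fx z) (fy z))) _ (cA 'i%R 0 _ PL)).
  congr Phi; apply/funext => v; rewrite addr0 !rlinE conjcM conjci.
  set a := wirt _ _ in wz *; set b := wirt_bar _ _.
  transitivity ((a * v + b * v^*%C - 'i%R * 'i%R * (a * v - b * v^*%C)) / (2 * a)).
    by field.
  by rewrite i2; field.
- have [z wz] : exists z, wirt_bar (fx z) (fy z) != 0.
    apply: contrapT => H; apply: nh; apply: (holomorphic_wirt_bar0 _ _ _ cf) => z.
    by apply/eqP; apply: contrapT => /negP wz; apply: H; exists z.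
  have PL := class_rlin _ _ _ _ z PC cf Pf.
  have := cD _ _ (cZ (2 * wirt_bar (fx z) (fy z))^-1 _ PL)
    (cZ ('i%R / (2 * wirt_bar (fx z) (fy z))) _ (cA 'i%R 0 _ PL)).
  congr Phi; apply/funext => v; rewrite addr0 !rlinE conjcM conjci.
  set a := wirt _ _; set b := wirt_bar _ _ in wz *.
  transitivity ((a * v + b * v^*%C + 'i%R * 'i%R * (a * v - b * v^*%C)) / (2 * b)).
    by field.
  by rewrite i2; field.
have [z [v Qv]] : exists z v, quad (fxx z) (fxy z) (fyx z) (fyy z) v != 0.
  apply: contrapT => H; apply: nr; apply: R_affine_rlin.
  apply: (affine_of_quad0 _ _ _ _ _ _ _ cf cfx cfy) => z v.
  by apply/eqP; apply: contrapT => /negP wz; apply: H; exists z, v.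
have PQ := class_quad _ _ _ _ _ _ _ _ z PC cf cfx cfy Pf.
have [A [B [C QE]]] := quadE (fxx z) (fxy z) (fyx z) (fyy z).
(* In [Q(w) + Q(i w)] both squares cancel and [2 B w (conj w)] remains. Only when [B = 0] is the
   rotation by [1 + i] used: it multiplies the two squares by [2 i] and [- 2 i], which separates
   them. *)
have [B0|B0] := eqVneq B 0; last first.
  constructor 2; have := cD _ _ (cZ (2 * B)^-1 _ PQ) (cZ (2 * B)^-1 _ (cA 'i%R 0 _ PQ)).
  congr Phi; apply/funext => w; rewrite addr0 !QE conjcM conjci.
  transitivity ((A * (w * w) * (1 + 'i%R * 'i%R) + B * (w * w^*%C) * (1 - 'i%R * 'i%R)
    + C * (w^*%C * w^*%C) * (1 + 'i%R * 'i%R)) / (2 * B)); first by field.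
  by rewrite i2; field.
have i2' : (1 + 'i%R) * (1 + 'i%R) = 2 * 'i%R :> R[i].
  by rewrite mulrDl !mulrDr i2; ring.
have i2'' : (1 - 'i%R) * (1 - 'i%R) = - 2 * 'i%R :> R[i].
  by rewrite mulrDl !mulrDr mulrNN i2; ring.
have [A0|A0] := eqVneq A 0; last first.
  constructor 1; have := cD _ _ (cZ (2 * A)^-1 _ PQ)
     (cZ (- 'i%R / (4 * A)) _ (cA (1 + 'i%R) 0 _ PQ)).
  congr Phi; apply/funext => w; rewrite addr0 !QE B0 !mul0r !addr0 conjcM conjcD conjc1 conjci.
  transitivity ((2 * (A * (w * w) + C * (w^*%C * w^*%C)) - 'i%R * ((1 + 'i%R) * (1 + 'i%R) * (A * (w * w))
    + (1 - 'i%R) * (1 - 'i%R) * (C * (w^*%C * w^*%C)))) / (4 * A)); first by field.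
  rewrite i2' i2''.
  transitivity ((2 * (A * (w * w) + C * (w^*%C * w^*%C)) - 2 * ('i%R * 'i%R) * (A * (w * w)
    - C * (w^*%C * w^*%C))) / (4 * A)); first by field.
  by rewrite i2; field.
have [C0|C0] := eqVneq C 0.
  by move: Qv; rewrite QE A0 B0 C0 !mul0r !addr0 eqxx.
constructor 3; have := cZ C^-1 _ PQ.
by congr Phi; apply/funext => w; rewrite QE A0 B0 !mul0r !add0r mulKf.
Qed.

End SecondOrder.

(** * The Stone-Weierstrass theorem *)

(** If [P K] failed, the sets [A] with [P (K \ A)] would form a proper filter containing [K]; a
    cluster point in [K] would contradict [P] on one of its neighbourhoods. *)
Lemma compact_ind (T : topologicalType) (K : set T) (P : set T -> Prop) :
  compact K -> P set0 -> (forall A B, A `<=` B -> P B -> P A) ->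
  (forall A B, P A -> P B -> P (A `|` B)) ->
  (forall x, K x -> exists2 U, nbhs x U & P U) -> P K.
Proof.
move=> cK P0 PS PU Ploc; apply: contrapT => nPK.
pose F : set_system T := fun A => P (K `\` A).
have FF : ProperFilter F.
  split; first by rewrite /F setD0.
  split; first by rewrite /F setDT.
    by move=> A B FA FB; rewrite /F setDIr; exact: PU.
  by move=> A B AB; apply: PS; exact: setDS.
have [|x [Kx clx]] := cK F FF; first by rewrite /F setDv.
have [U xU PU'] := Ploc x Kx.
have [|y []] := clx (~` U) U _ xU; last by [].
by apply: PS PU' => z [_ /contrapT].
Qed.

Section StoneWeierstrass.
Context {R : realType} {T : topologicalType} (K : set T) (A : set (T -> R)).
Context (cK : compact K).
Context (A_continuous : forall f, A f -> continuous f).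
Context (A_cst : forall c, A (fun=> c)).
Context (A_add : forall f g, A f -> A g -> A (fun x => f x + g x)).
Context (A_mul : forall f g, A f -> A g -> A (fun x => f x * g x)).
Context (A_sep : forall x y, x <> y -> exists2 f, A f & f x <> f y).
Context (A_lim : forall f, continuous f ->
  (forall e, 0 < e -> exists2 g, A g & forall x, K x -> `|g x - f x| <= e) -> A f).

Lemma continuous_bounded (f : T -> R) : continuous f ->
  exists2 M, 0 < M & forall x, K x -> `|f x| <= M.
Proof.
move=> fc; apply: (compact_ind _ _ (fun U => exists2 M, 0 < M & forall x, U x -> `|f x| <= M)) => //.
- by exists 1.
- by move=> B C BC [M M0 MP]; exists M => // x /BC /MP.
- move=> B C [M M0 MP] [N N0 NP]; exists (M + N); first by rewrite addr_gt0.
  by move=> x [/MP|/NP] ?; lra.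
move=> x Kx; exists [set y | `|f y| <= `|f x| + 1].
  have /cvgrPdist_lt/(_ 1 ltr01) := fc x; apply: filterS => y /= xy.
  by have := ler_distD (f x) (f y) 0; rewrite !subr0 distrC; lra.
by exists (`|f x| + 1) => //; rewrite ltr_wpDl.
Qed.

(* [u_{n+1} = u_n + (q^2 - u_n^2) / 2] increases to [|q|], with error at most [2 / (n + 2)]. *)
Fixpoint abs_approx (q : R) (n : nat) : R :=
  if n is n'.+1 then let u := abs_approx q n' in u + (q * q - u * u) / 2 else 0.

Lemma abs_approxP q n : `|q| <= 1 ->
  0 <= abs_approx q n /\ 0 <= `|q| - abs_approx q n <= 2 / (n%:R + 2).
Proof.
move=> q1; elim: n => [|n [u0 /andP[du ud]]] /=.
  by rewrite subr0 normr_ge0 add0r divff ?q1.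
set u := abs_approx q n in u0 du ud *.
have -> : q * q = `|q| * `|q| by rewrite -normrM ger0_norm// -expr2 sqr_ge0.
set d := `|q| - u in du ud *.
have qE : `|q| = u + d by rewrite /d; ring.
have n0 : 0 <= n%:R :> R by exact: ler0n.
have q0 := normr_ge0 q.
split; first by nra.
have -> : `|q| - (u + (`|q| * `|q| - u * u) / 2) = d * (1 - (`|q| + u) / 2).
  by rewrite /d; field.
apply/andP; split; first by rewrite mulr_ge0//; lra.
(* Since [|q| + u = d + 2 u >= d], the error obeys [d' <= d - d^2 / 2]. This map is increasing on
   [[0, 1]], so the bound [b] on [d] can be inserted. *)
have le1 : d * (1 - (`|q| + u) / 2) <= d - d * d / 2 by nra.
rewrite (le_trans le1)//.
have n20 : 0 < n%:R + 2 :> R by lra.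
set b := 2 / (n%:R + 2) in ud.
have b1 : b <= 1 by rewrite /b ler_pdivrMr//; lra.
have le2 : d - d * d / 2 <= b - b * b / 2 by nra.
rewrite (le_trans le2)// -natr1 /b ler_pdivlMr; last by lra.
rewrite (_ : (_ - _) * _ = 2 - 2 / (n%:R + 2) ^+ 2); last by field; lra.
by rewrite gerBl divr_ge0// sqr_ge0.
Qed.

Lemma A_scale c f : A f -> A (fun x => c * f x).
Proof. by move=> Af; apply: A_mul. Qed.

Lemma A_abs f : A f -> A (fun x => `|f x|).
Proof.
move=> Af; have fc := A_continuous _ Af; apply: A_lim.
  by move=> x; apply: (@continuous_comp _ _ _ f (fun y => `|y|)); [exact: fc|exact: norm_continuous].
move=> e e0; have [M M0 MP] := continuous_bounded _ fc.
have Aq n : A (fun x => abs_approx (M^-1 * f x) n).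
  elim: n => [|n IH] /=; first exact: A_cst.
  have Aff := A_scale M^-1 f Af.
  have -> : (fun x => abs_approx (M^-1 * f x) n + (M^-1 * f x * (M^-1 * f x) -
     abs_approx (M^-1 * f x) n * abs_approx (M^-1 * f x) n) / 2) =
    (fun x => abs_approx (M^-1 * f x) n + (2^-1 * ((M^-1 * f x) * (M^-1 * f x)) +
     (- 2^-1) * (abs_approx (M^-1 * f x) n * abs_approx (M^-1 * f x) n))).
    by apply/funext => x; field; rewrite gt_eqF.
  apply: A_add => //; apply: (A_add (fun x => _) (fun x => _));
    by apply: (A_scale _ (fun x => _)); apply: (A_mul (fun x => _) (fun x => _)).
(* After rescaling by [M] the error is at most [2 M / (n + 2)], and [n + 1 > 2 M / e]. *)
pose n := Num.trunc (2 * M / e).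
exists (fun x => M * abs_approx (M^-1 * f x) n); first exact: A_scale.
move=> x /MP fM.
have q1 : `|M^-1 * f x| <= 1.
  by rewrite normrM gtr0_norm ?invr_gt0// mulrC ler_pdivrMr// mul1r.
have [_ /andP[d1 d2]] := abs_approxP _ n q1.
have fE : `|f x| = M * `|M^-1 * f x|.
  by rewrite normrM gtr0_norm ?invr_gt0// mulVKf// gt_eqF.
rewrite fE -mulrBr normrM (gtr0_norm M0) distrC ger0_norm//.
have n20 : 0 < n%:R + 2 :> R by rewrite ltr_wpDl.
rewrite (le_trans (ler_wpM2l (ltW M0) d2))// mulrA ler_pdivrMr// -ler_pdivrMl//.
rewrite (_ : e^-1 * (M * 2) = 2 * M / e); last by ring.
have := Num.Theory.truncnS_gt (2 * M / e); rewrite -/n -natr1 => H.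
by lra.
Qed.

Lemma maxr_abs (x y : R) : Num.max x y = 2^-1 * (x + y + `|x - y|).
Proof. by rewrite maxr_absE mulrC. Qed.

Lemma A_opp f : A f -> A (fun x => - f x).
Proof. by move=> /(A_scale (-1)); congr A; apply/funext => x; rewrite mulN1r. Qed.

Lemma A_max f g : A f -> A g -> A (fun x => Num.max (f x) (g x)).
Proof.
move=> Af Ag; under eq_fun do rewrite maxr_abs.
apply: (A_scale _ (fun x => _)); apply: (A_add (fun x => _) (fun x => _)); first exact: A_add.
by apply: (A_abs (fun x => _)); apply: A_add => //; exact: A_opp.
Qed.

Lemma A_min f g : A f -> A g -> A (fun x => Num.min (f x) (g x)).
Proof.
move=> Af Ag; under eq_fun do rewrite -[Num.min _ _]opprK oppr_min.
by apply: (A_opp (fun x => _)); apply: A_max; exact: A_opp.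
Qed.

Lemma A_interpolate (x y : T) (a b : R) : (x = y -> a = b) ->
  exists2 f, A f & f x = a /\ f y = b.
Proof.
have [<- /(_ erefl) <-|xy _] := pselect (x = y); first by exists (fun=> a).
have [f Af fxy] := A_sep _ _ xy.
have d0 : f y - f x != 0 by rewrite subr_eq0; apply/eqP => /esym.
exists (fun z => a + ((b - a) / (f y - f x)) * (f z + - f x)).
  apply: (A_add (fun=> a) (fun z => _)) => //.
  by apply: (A_scale _ (fun z => _)); apply: (A_add _ (fun=> _)).
by split; field.
Qed.

Lemma near_lt (f g : T -> R) x : continuous f -> continuous g -> f x < g x ->
  nbhs x [set y | f y < g y].
Proof.
move=> fc gc fgx; pose e := (g x - f x) / 2.
have e0 : 0 < e by rewrite /e; lra.
have /cvgrPdist_lt/(_ e e0) := fc x; have /cvgrPdist_lt/(_ e e0) := gc x.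
by apply: filterS2 => y /=; rewrite !ltr_distl /e; lra.
Qed.

Theorem Stone_Weierstrass f : continuous f -> A f.
Proof.
move=> fc; apply: A_lim => // e e0.
(* A point [x0] is needed to start the second compactness argument, whose empty case still asks for
   a lower bound on all of [K]. *)
have [K0|[x0 Kx0]] : K = set0 \/ K !=set0.
- by have [->|/set0P] := eqVneq K set0; [left|right].
- by exists (fun=> 0) => // x; rewrite K0.
have fec (c : R) : continuous (fun y => f y + c).
  by move=> y; apply: cvgD; [exact: fc|exact: cvg_cst].
(* A maximum of finitely many interpolants, all equal to [f x] at [x]. *)
have above x : K x -> exists2 g, A g & g x = f x /\ forall y, K y -> f y + - e < g y.
  move=> Kx.
  apply: (compact_ind _ _ (fun U => exists2 g, A g & g x = f x /\ forall y, U y -> f y + - e < g y)) => //.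
  - by exists (fun=> f x).
  - by move=> B C BC [g Ag [gx gP]]; exists g => //; split => // y /BC /gP.
  - move=> B C [g Ag [gx gP]] [h Ah [hx hP]].
    exists (fun y => Num.max (g y) (h y)); first exact: A_max.
    split=> [|y]; first by rewrite gx hx maxxx.
    by move=> [/gP|/hP] ?; rewrite lt_max; apply/orP; [left|right].
  move=> y Ky; have [|g Ag [gx gy]] := A_interpolate x y (f x) (f y); first by move=> ->.
  exists [set z | f z + - e < g z].
    by apply: (near_lt (fun z => f z + - e)) => //; [exact: A_continuous|rewrite gy; lra].
  by exists g.
(* A minimum of finitely many functions from [above]: the lower bound is kept on all of [K] while
   the set carrying the upper bound grows. *)
have [g Ag gP] : exists2 g, A g & (forall y, K y -> f y + - e < g y) /\ forall y, K y -> g y < f y + e.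
  apply: (compact_ind _ _ (fun U => exists2 g, A g & (forall y, K y -> f y + - e < g y) /\
     forall y, U y -> g y < f y + e)) => //.
  - by have [g Ag [_ gP]] := above x0 Kx0; exists g.
  - by move=> B C BC [g Ag [gx gP]]; exists g => //; split => // y /BC /gP.
  - move=> B C [g Ag [gx gP]] [h Ah [hx hP]].
    exists (fun y => Num.min (g y) (h y)); first exact: A_min.
    split=> [y Ky|y]; first by rewrite lt_min gx ?hx.
    by move=> [/gP|/hP] ?; rewrite gt_min; apply/orP; [left|right].
  move=> x Kx; have [g Ag [gx gP]] := above x Kx.
  exists [set z | g z < f z + e]; last by exists g.
  by apply: (near_lt g) => //; [exact: A_continuous|rewrite gx; lra].
exists g => // x Kx; case: gP => /(_ x Kx) g1 /(_ x Kx) g2.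
by rewrite ler_distl; lra.
Qed.

End StoneWeierstrass.

(** * Blocks of one hidden layer *)

Section UniformContinuity.
Context {R : realType}.

(** Compactness is used on the square [[-M, M]^2] of real coordinate pairs, which contains the disc;
    [w] itself may leave it. *)
Lemma continuous_unif_bounded (f : R[i] -> R[i]) : continuous f -> forall M e : R, 0 < e ->
  exists2 d : R, 0 < d & forall z w, nc z <= M -> nc (w - z) < d -> nc (f w - f z) < e.
Proof.
move=> fc M e e0.
pose Q (d : R) (p : R * R) :=
  forall w, nc (w - (p.1 +i* p.2)) < d -> nc (f w - f (p.1 +i* p.2)) < e.
have [d d0 dP] : exists2 d : R, 0 < d &
    forall p, (`[- M, M] `*` `[- M, M])%classic p -> Q d p.
  apply: (compact_ind _ _ (fun U => exists2 d : R, 0 < d & forall p, U p -> Q d p)) => //.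
  - by apply: compact_setX; exact: segment_compact.
  - by exists 1.
  - by move=> B C BC [d d0 dP]; exists d => // p /BC /dP.
  - move=> B C [d d0 dP] [d' d'0 d'P]; exists (Num.min d d'); first by rewrite lt_min d0.
    move=> p [/dP|/d'P] H w; rewrite lt_min => /andP[h1 h2]; exact: H.
  move=> [x y] _ /=; have e20 : 0 < e / 2 by lra.
  have [d d0 dP] := continuous_ncP fc (x +i* y) _ e20.
  have d40 : 0 < d / 4 by lra.
  exists (ball (x, y) (d / 4)); first exact: nbhsx_ballx.
  exists (d / 2); first by lra.
  move=> [x' y'] [/= bx by'] w /= wd.
  have b : nc ((x' +i* y') - (x +i* y)) < d / 2.
    rewrite (le_lt_trans (nc_le_ReIm _))//=.
    by move: bx by'; rewrite /ball /= distrC [`|y - _|]distrC; lra.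
  have b1 : nc (f (x' +i* y') - f (x +i* y)) < e / 2 by apply: dP; lra.
  have b2 : nc (f w - f (x +i* y)) < e / 2.
    by apply: dP; have := nc_dist (x' +i* y') w (x +i* y); lra.
  have := nc_dist (f (x +i* y)) (f w) (f (x' +i* y')).
  by rewrite [nc (f (x +i* y) - _)]ncBC; lra.
exists d => // z w zM wz.
have zE : z = complex.Re z +i* complex.Im z by case: z {zM wz}.
have := dP (complex.Re z, complex.Im z); rewrite /Q /= -zE; apply => //.
have := Re_le_nc z; have := Im_le_nc z; rewrite !ler_norml => /andP[? ?] /andP[? ?].
by split => /=; rewrite in_itv /=; apply/andP; split; lra.
Qed.

(** Walk from 0 to [z] in [k] steps shorter than the modulus of continuity for 1; each step changes
    [f] by less than 1. *)
Lemma continuous_nc_bounded (f : R[i] -> R[i]) : continuous f -> forall M : R,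
  exists N : R, forall z, nc z <= M -> nc (f z) <= N.
Proof.
move=> fc M; have [d d0 dP] := continuous_unif_bounded f fc `|M| 1 ltr01.
pose k := (Num.trunc (`|M| / d)).+1.
have Mk : `|M| / k%:R < d.
  rewrite ltr_pdivrMr ?ltr0n// mulrC -ltr_pdivrMr//.
  exact: Num.Theory.truncnS_gt.
have k0 : 0 < k%:R :> R by rewrite ltr0n.
have step z j : nc z <= `|M| -> (j <= k)%N -> nc (f ((j%:R / k%:R)%:C * z)) <= nc (f 0) + j%:R.
  move=> zM; elim: j => [|j IH] jk; first by rewrite mul0r mul0r addr0.
  have := IH (ltnW jk); rewrite -natr1.
  set w := (_ / _)%:C * z => Hw; set w' := (_ / _)%:C * z.
  have : nc (f w' - f w) < 1.
    apply: dP.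
      rewrite ncM ncR ger0_norm ?divr_ge0// (le_trans _ zM)// ler_piMl ?nc_ge0//.
      by rewrite ler_pdivrMr// mul1r ler_nat ltnW.
    rewrite /w /w' -mulrBl -rmorphB -mulrBl addrC addKr /= mul1r ncM ncR.
    rewrite ger0_norm ?invr_ge0// mulrC (le_lt_trans _ Mk)//.
    by apply: ler_wpM2r => //; rewrite invr_ge0 ltW.
  by have := ncD (f w' - f w) (f w); rewrite subrK; lra.
exists (nc (f 0) + k%:R) => z zM.
have := step z k (le_trans zM (ler_norm _)) (leqnn _).
by rewrite divff ?gt_eqF// mul1r.
Qed.

End UniformContinuity.

Section RowNorm.
Context {R : realType}.

Definition rn {k} (s : 'rV[R[i]]_k) : R := \sum_j nc (s 0 j).

Lemma rn_ge0 k (s : 'rV_k) : 0 <= rn s.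
Proof. by apply: sumr_ge0 => j _; exact: nc_ge0. Qed.

Lemma nc_le_rn k (s : 'rV_k) j : nc (s 0 j) <= rn s.
Proof. by rewrite /rn (bigD1 j)//= lerDl; apply: sumr_ge0 => i _; exact: nc_ge0. Qed.

Lemma rnD k (s t : 'rV_k) : rn (s + t) <= rn s + rn t.
Proof. by rewrite /rn -big_split ler_sum// => j _; rewrite mxE ncD. Qed.

Lemma rnN k (s : 'rV_k) : rn (- s) = rn s.
Proof. by apply: eq_bigr => j _; rewrite mxE ncN. Qed.

Lemma rnBC k (s t : 'rV_k) : rn (s - t) = rn (t - s).
Proof. by rewrite -rnN opprB. Qed.

Lemma rn_dist k (u s t : 'rV_k) : rn (s - t) <= rn (s - u) + rn (u - t).
Proof. by rewrite -[s - t](subrKA u) rnD. Qed.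

Lemma rn0 k : rn (0 : 'rV_k) = 0.
Proof. by rewrite /rn big1// => j _; rewrite mxE nc0. Qed.

Lemma rnZ k (c : R[i]) (s : 'rV_k) : rn (c *: s) = nc c * rn s.
Proof. by rewrite /rn mulr_sumr; apply: eq_bigr => j _; rewrite mxE ncM. Qed.

Lemma rn_mulmx k l (A : 'M[R[i]]_(k, l)) : exists2 C : R, 0 < C &
  forall s, rn (s *m A) <= C * rn s.
Proof.
exists (1 + \sum_i \sum_j nc (A i j)).
  by rewrite ltr_wpDr//; do 2![apply: sumr_ge0 => ? _]; exact: nc_ge0.
move=> s; apply: (@le_trans _ _ (\sum_j \sum_i nc (s 0 i) * nc (A i j))).
  apply: ler_sum => j _; rewrite mxE.
  elim/big_ind2 : _ => [|x x' y y' hx hy|i _]; first by rewrite nc0.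
    by rewrite (le_trans (ncD _ _))// lerD.
  by rewrite ncM.
rewrite exchange_big mulrDl mul1r mulr_suml ler_wpDl ?rn_ge0//.
apply: ler_sum => i _; rewrite -mulr_sumr mulrC ler_wpM2l ?nc_le_rn//.
by apply: sumr_ge0 => ? _; exact: nc_ge0.
Qed.

Lemma rn_small k (s : 'rV[R[i]]_k) (e : R) : 0 < e ->
  (forall j, nc (s 0 j) < e / k.+1%:R) -> rn s < e.
Proof.
move=> e0 H; apply: (@le_lt_trans _ _ (\sum_(j < k) e / k.+1%:R)).
  by apply: ler_sum => j _; exact/ltW/H.
rewrite sumr_const card_ord -[_ *+ k]mulr_natr mulrAC ltr_pdivrMr ?ltr0n// ltr_pM2l//.
by rewrite ltr_nat.
Qed.

Definition bounded_map {k l} (G : 'rV[R[i]]_k -> 'rV[R[i]]_l) :=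
  forall M : R, exists N : R, forall s, rn s <= M -> rn (G s) <= N.

(** Only [s] is bounded: [s'] will be the state actually computed, known through its distance to the
    ideal state [s]. *)
Definition ucont_bounded {k l} (G : 'rV[R[i]]_k -> 'rV[R[i]]_l) :=
  forall M e : R, 0 < e -> exists2 d : R, 0 < d &
  forall s s', rn s <= M -> rn (s' - s) < d -> rn (G s' - G s) < e.

Lemma bounded_map_comp k l p (G : 'rV_k -> 'rV_l) (H : 'rV_l -> 'rV_p) :
  bounded_map G -> bounded_map H -> bounded_map (fun s => H (G s)).
Proof. by move=> bG bH M; have [N NP] := bG M; have [N' N'P] := bH N; exists N' => s /NP /N'P. Qed.

Lemma ucont_bounded_comp k l p (G : 'rV_k -> 'rV_l) (H : 'rV_l -> 'rV_p) :
  bounded_map G -> ucont_bounded G -> ucont_bounded H -> ucont_bounded (fun s => H (G s)).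
Proof.
move=> bG uG uH M e e0; have [N NP] := bG M.
have [d d0 dP] := uH N e e0; have [d' d'0 d'P] := uG M d d0.
by exists d' => // s s' sM ss; apply: dP; [exact: NP|exact: d'P].
Qed.

Lemma bounded_map_aff k l (A : 'M[R[i]]_(k, l)) b : bounded_map (affmap A b).
Proof.
move=> M; have [C C0 CP] := rn_mulmx _ _ A; exists (C * M + rn b) => s sM.
by rewrite (le_trans (rnD _ _ _))// lerD2r (le_trans (CP s))// ler_pM2l.
Qed.

Lemma affmapB k l (A : 'M[R[i]]_(k, l)) b s s' : affmap A b s' - affmap A b s = (s' - s) *m A.
Proof. by rewrite /affmap mulmxBl opprD addrACA subrr addr0. Qed.

Lemma ucont_bounded_aff k l (A : 'M[R[i]]_(k, l)) b : ucont_bounded (affmap A b).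
Proof.
move=> M e e0; have [C C0 CP] := rn_mulmx _ _ A; exists (e / C); first exact: divr_gt0.
by move=> s s' _ ss; rewrite affmapB (le_lt_trans (CP _))// mulrC -ltr_pdivlMr.
Qed.

Section Activation.
Context (rho : R[i] -> R[i]) (rhoc : continuous rho).

Lemma bounded_map_actv k : bounded_map (@actv R rho k).
Proof.
move=> M; have [N NP] := continuous_nc_bounded rho rhoc M; exists (\sum_(j < k) N) => s sM.
apply: ler_sum => j _; rewrite mxE; apply: NP.
exact: le_trans (nc_le_rn _ _ _) sM.
Qed.

Lemma ucont_bounded_actv k : ucont_bounded (@actv R rho k).
Proof.
move=> M e e0; have ek : 0 < e / k.+1%:R by rewrite divr_gt0// ltr0n.
have [d d0 dP] := continuous_unif_bounded rho rhoc M _ ek.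
exists d => // s s' sM ss; apply: rn_small => // j; rewrite !mxE; apply: dP.
  exact: le_trans (nc_le_rn _ _ _) sM.
by have := nc_le_rn _ (s' - s) j; rewrite !mxE => /le_lt_trans; apply.
Qed.

Definition block {k W l} (A : 'M[R[i]]_(k, W)) b (B : 'M[R[i]]_(W, l)) c s :=
  affmap B c (actv rho (affmap A b s)).

Lemma ucont_bounded_block k W l (A : 'M[R[i]]_(k, W)) b (B : 'M[R[i]]_(W, l)) c : ucont_bounded (block A b B c).
Proof.
apply: (ucont_bounded_comp _ _ _ (fun s => actv rho (affmap A b s)));
  [apply: bounded_map_comp|apply: ucont_bounded_comp|exact: ucont_bounded_aff].
- exact: bounded_map_aff.
- exact: bounded_map_actv.
- exact: bounded_map_aff.
- exact: ucont_bounded_aff.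
- exact: ucont_bounded_actv.
Qed.

(** The width [W] is fixed before the radius and the accuracy; only the weights depend on these. *)
Definition block_approx {k l} W (G : 'rV[R[i]]_k -> 'rV[R[i]]_l) :=
  forall M e : R, 0 < e -> exists (A : 'M[R[i]]_(k, W)) b (B : 'M[R[i]]_(W, l)) c,
  forall s, rn s <= M -> rn (block A b B c s - G s) < e.

(** Two hidden layers are placed side by side and their outputs summed, so the widths add. *)
Lemma block_approxD k l W1 W2 (G1 G2 : 'rV_k -> 'rV_l) :
  block_approx W1 G1 -> block_approx W2 G2 ->
  block_approx (W1 + W2) (fun s => G1 s + G2 s).
Proof.
move=> H1 H2 M e e0; have e20 : 0 < e / 2 by lra.
have [A1 [b1 [B1 [c1 P1]]]] := H1 M _ e20; have [A2 [b2 [B2 [c2 P2]]]] := H2 M _ e20.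
exists (row_mx A1 A2), (row_mx b1 b2), (col_mx B1 B2), (c1 + c2) => s sM.
rewrite (_ : _ - _ = (block A1 b1 B1 c1 s - G1 s) + (block A2 b2 B2 c2 s - G2 s)).
  by rewrite (le_lt_trans (rnD _ _ _))//; have := P1 s sM; have := P2 s sM; lra.
rewrite /block /affmap mul_mx_row add_row_mx /actv map_row_mx mul_row_col.
by rewrite [RHS]addrACA [X in _ = X + _]addrACA opprD.
Qed.

Lemma block_approx_post k l p W (G : 'rV_k -> 'rV_l) (B : 'M[R[i]]_(l, p)) :
  block_approx W G -> block_approx W (fun s => G s *m B).
Proof.
move=> H M e e0; have [C C0 CP] := rn_mulmx _ _ B.
have [A [b [B' [c P]]]] := H M _ (divr_gt0 e0 C0).
exists A, b, (B' *m B), (c *m B) => s /P sM.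
rewrite /block /affmap mulmxA -mulmxDl -mulmxBl (le_lt_trans (CP _))// mulrC -ltr_pdivlMr//.
Qed.

Lemma block_approx_pre k l p W (G : 'rV_k -> 'rV_l) (B : 'M[R[i]]_(p, k)) :
  block_approx W G -> block_approx W (fun s => G (s *m B)).
Proof.
move=> H M e e0; have [C C0 CP] := rn_mulmx _ _ B.
have [A [b [B' [c P]]]] := H (C * M) _ e0.
exists (B *m A), b, B', c => s sM.
have := P (s *m B); rewrite /block /affmap mulmxA; apply.
by rewrite (le_trans (CP _))// ler_pM2l.
Qed.

Lemma block_approx_neuron k l (a : 'M[R[i]]_(k, 1)) (b : R[i]) (c : 'rV_l) :
  block_approx 1 (fun s => rho ((s *m a) 0 0 + b) *: c).
Proof.
move=> M e e0; exists a, b%:M, c, 0 => s _.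
rewrite (_ : _ - _ = 0) ?rn0//; apply/eqP; rewrite subr_eq0; apply/eqP.
rewrite /block /affmap addr0 [actv _ _]mx11_scalar mul_scalar_mx; congr (_ *: _).
by rewrite !mxE eqxx mulr1n.
Qed.

(** One neuron per coordinate computes the difference quotient; the subtracted constant [rho z / h]
    goes into the output bias and costs no neuron. *)
Lemma block_approx_rlin k rx ry z : c1 rho rx ry ->
  block_approx k (fun s : 'rV_k => map_mx (rlin (rx z) (ry z)) s).
Proof.
move=> rc M e e0; have ek : 0 < e / k.+1%:R by rewrite divr_gt0// ltr0n.
have [h h0 hP] := first_difference rc z M _ ek.
exists h%:C%:M, (const_mx z), (h%:C^-1)%:M, (const_mx (- (rho z / h%:C))) => s sM.
apply: rn_small => // j; rewrite /block /affmap !mul_mx_scalar !mxE.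
have := hP (s 0 j) (le_trans (nc_le_rn _ _ _) sM).
by rewrite mulrBl [z + _]addrC [_ / h%:C as X in X - _]mulrC.
Qed.

End Activation.
End RowNorm.

(** * Networks as register machines *)

Section Networks.
Context {R : realType} (rho : R[i] -> R[i]) (rhoc : continuous rho) (n W : nat).

(** The output map of [f] and the input map of the block merge into one affine map between hidden
    layers, so the number of registers never enters the width. *)
Lemma NN_block k l f (A : 'M[R[i]]_(k, W)) b (B : 'M[R[i]]_(W, l)) c :
  NN rho n k W f -> NN rho n l W (fun z => block rho A b B c (f z)).
Proof.
move=> [A1 [b1 [hid [AL [bL ->]]]]].
exists A1, b1, (rcons hid (AL *m A, bL *m A + b)), B, c; apply/funext => z.
by rewrite foldl_rcons /block /affmap /= mulmxDl -!mulmxA addrA.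
Qed.

Lemma NN_affine k l f (B : 'M[R[i]]_(k, l)) c :
  NN rho n k W f -> NN rho n l W (fun z => affmap B c (f z)).
Proof.
move=> [A1 [b1 [hid [AL [bL ->]]]]].
exists A1, b1, hid, (AL *m B), (bL *m B + c); apply/funext => z.
by rewrite /affmap mulmxDl -!mulmxA addrA.
Qed.

Lemma NN_block_affine k l (P : 'M[R[i]]_(n, k)) p (A : 'M[R[i]]_(k, W)) b (B : 'M[R[i]]_(W, l)) c :
  NN rho n l W (fun z => block rho A b B c (affmap P p z)).
Proof.
exists (P *m A), (p *m A + b), [::], B, c; apply/funext => z.
by rewrite /block /affmap /= mulmxDl -!mulmxA addrA.
Qed.

Lemma NN_bmap k f : NN rho n k W f -> bounded_map f.
Proof.
move=> [A1 [b1 [hid [AL [bL ->]]]]].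
apply: (bounded_map_comp _ _ _ (fun z => actv rho _)); last exact: bounded_map_aff.
apply: bounded_map_comp; last exact: bounded_map_actv.
elim/last_ind: hid => [|hid V IH] /=; first exact: bounded_map_aff.
under eq_fun do rewrite foldl_rcons.
apply: (bounded_map_comp _ _ _ (fun z => actv rho _)); last exact: bounded_map_aff.
by apply: bounded_map_comp IH _; exact: bounded_map_actv.
Qed.

Context (K : set 'rV[R[i]]_n) (MK : R) (KM : forall z, K z -> rn z <= MK).

Definition approx {k} (F : 'rV[R[i]]_n -> 'rV[R[i]]_k) := forall e : R, 0 < e ->
  exists2 f, NN rho n k W f & forall z, K z -> rn (f z - F z) < e.

Lemma approx_bounded k (F : 'rV_n -> 'rV_k) : approx F ->
  exists M : R, forall z, K z -> rn (F z) <= M.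
Proof.
move=> /(_ 1 ltr01)[f Nf fF]; have [M MP] := NN_bmap _ _ Nf MK.
exists (M + 1) => z Kz; have := MP z (KM z Kz); have := fF z Kz.
by have := rnD _ (f z) (F z - f z); rewrite addrC subrK rnBC; lra.
Qed.

Lemma approx_lim k (F : 'rV_n -> 'rV_k) : (forall e : R, 0 < e ->
  exists2 G, approx G & forall z, K z -> rn (G z - F z) < e) -> approx F.
Proof.
move=> H e e0; have e20 : 0 < e / 2 by lra.
have [G aG GF] := H _ e20; have [f Nf fG] := aG _ e20.
exists f => // z Kz; have := fG z Kz; have := GF z Kz.
by have := rn_dist _ (G z) (f z) (F z); lra.
Qed.

Lemma approx_affine k l (F : 'rV_n -> 'rV_k) (B : 'M[R[i]]_(k, l)) c :
  approx F -> approx (fun z => affmap B c (F z)).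
Proof.
move=> aF e e0; have [C C0 CP] := rn_mulmx _ _ B.
have [f Nf fF] := aF _ (divr_gt0 e0 C0).
exists (fun z => affmap B c (f z)); first exact: NN_affine.
by move=> z /fF ?; rewrite affmapB (le_lt_trans (CP _))// mulrC -ltr_pdivlMr.
Qed.

(** The block is chosen first, on a ball containing the values of [F]; its uniform continuity then
    dictates how well [F] must be approximated. *)
Lemma approx_comp k l (F : 'rV_n -> 'rV_k) (G : 'rV_k -> 'rV_l) :
  approx F -> block_approx rho W G -> approx (fun z => G (F z)).
Proof.
move=> aF bG e e0; have e20 : 0 < e / 2 by lra.
have [M MP] := approx_bounded _ _ aF.
have [A [b [B [c P]]]] := bG M _ e20.
have [d d0 dP] := ucont_bounded_block rho rhoc _ _ _ A b B c M _ e20.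
have [f Nf fF] := aF _ d0.
exists (fun z => block rho A b B c (f z)); first exact: NN_block.
move=> z Kz; rewrite (le_lt_trans (rn_dist _ (block rho A b B c (F z)) _ _))//.
by rewrite [e]splitr ltrD ?P ?dP ?MP ?fF.
Qed.

(** Starts a computation: a network has at least one activation layer, so the initial affine map has
    to pass through a block. *)
Lemma approx_block_affine k l (P : 'M[R[i]]_(n, k)) p (G : 'rV_k -> 'rV_l) :
  block_approx rho W G -> approx (fun z => G (affmap P p z)).
Proof.
move=> bG e e0; have [M MP] := bounded_map_aff _ _ P p MK.
have [A [b [B [c H]]]] := bG M _ e0.
exists (fun z => block rho A b B c (affmap P p z)); first exact: NN_block_affine.
by move=> z /KM /MP /H.
Qed.

(** The activations that can be added to a register. The condition [c *m a = 0] says that writing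
    along [c] does not alter the value read by [a], so two additions in succession add the sum. *)
Definition steps k : set (R[i] -> R[i]) := [set phi |
  forall (a : 'M[R[i]]_(k, 1)) (b : R[i]) (c : 'rV[R[i]]_k) F, c *m a = 0 -> approx F ->
  approx (fun z => F z + phi ((F z *m a) 0 0 + b) *: c)].

Lemma steps_closed k : closed_class (steps k).
Proof.
split.
- move=> f g Sf Sg a b c F ca aF.
  have := Sg a b c _ ca (Sf a b c F ca aF); congr approx; apply/funext => z.
  by rewrite mulmxDl -scalemxAl ca scaler0 addr0 scalerDl addrA.
- move=> l f Sf a b c F ca aF.
  have := Sf a b (l *: c) F; rewrite -scalemxAl ca scaler0 => /(_ erefl aF).
  by under eq_fun do rewrite scalerA mulrC.
- move=> al be f Sf a b c F ca aF.
  have := Sf (al *: a) (al * b + be) c F; rewrite -scalemxAr ca scaler0 => /(_ erefl aF).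
  by under eq_fun do rewrite -scalemxAr mxE addrA -mulrDr.
move=> f Sf a b c F ca aF; apply: approx_lim => e e0.
have [M MP] := approx_bounded _ _ aF; have [C C0 CP] := rn_mulmx _ _ a.
have c1 : 0 < rn c + 1 by rewrite ltr_wpDl ?rn_ge0.
(* On [K] the values read stay in this disc, so approximation of [f] on discs is enough. *)
have [g Sg gf] := Sf (C * M + nc b) _ (divr_gt0 e0 c1).
exists (fun z => F z + g ((F z *m a) 0 0 + b) *: c); first exact: Sg.
move=> z Kz; set x := _ + b.
rewrite opprD addrACA subrr add0r -scalerBl rnZ.
have xM : nc x <= C * M + nc b.
  rewrite (le_trans (ncD _ _))// lerD2r (le_trans (nc_le_rn _ _ _))//.
  by rewrite (le_trans (CP _))// ler_pM2l// MP.
have := gf x xM; rewrite ltr_pdivlMr//; apply: le_lt_trans.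
by rewrite ler_wpM2l ?nc_ge0// lerDl.
Qed.

End Networks.

(** * Polynomials in the coordinates and their conjugates *)

Section Monomials.
Context {R : realType} {n : nat}.

(** The constructors are the operations available on the monomial register. A factor [conj (z 0 i)]
    arises by conjugating before and after a multiplication. *)
Inductive mon : ('rV[R[i]]_n -> R[i]) -> Prop :=
| mon1 : mon (fun=> 1)
| monJ f : mon f -> mon (fun z => (f z)^*%C)
| monX i f : mon f -> mon (fun z => f z * z 0 i).

Inductive pol : ('rV[R[i]]_n -> R[i]) -> Prop :=
| pol0 : pol (fun=> 0)
| polD c f p : mon f -> pol p -> pol (fun z => c * f z + p z).

Lemma mon_mul f g : mon f -> mon g -> mon (fun z => f z * g z).
Proof.
move=> mf; elim: mf g => [|{}f mf IH|i {}f mf IH] g mg.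
- by under eq_fun do rewrite mul1r.
- under eq_fun do rewrite -[g _]conjcK -conjcM.
  by apply: monJ; apply: (IH (fun z => _)); exact: monJ.
- by under eq_fun do rewrite mulrAC; apply: monX; exact: IH.
Qed.

Lemma pol_mon c f : mon f -> pol (fun z => c * f z).
Proof. by move=> mf; under eq_fun do rewrite -[_ * _]addr0; apply: polD => //; exact: pol0. Qed.

Lemma pol_add p q : pol p -> pol q -> pol (fun z => p z + q z).
Proof.
move=> pp; elim: pp => [|c f {}p mf _ IH] pq.
  by under eq_fun do rewrite add0r.
by under eq_fun do rewrite -addrA; apply: polD => //; exact: IH.
Qed.

Lemma pol_scale c p : pol p -> pol (fun z => c * p z).
Proof.
elim=> [|d f {}p mf _ IH]; first by under eq_fun do rewrite mulr0; exact: pol0.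
by under eq_fun do rewrite mulrDr mulrA; exact: polD.
Qed.

Lemma pol_mul_mon p f : pol p -> mon f -> pol (fun z => p z * f z).
Proof.
move=> pp mf; elim: pp => [|c g {}p mg _ IH].
  by under eq_fun do rewrite mul0r; exact: pol0.
under eq_fun do rewrite mulrDl -mulrA.
by apply: (polD _ (fun z => _)) => //; exact: mon_mul.
Qed.

Lemma pol_mul p q : pol p -> pol q -> pol (fun z => p z * q z).
Proof.
move=> pp; elim=> [|c f {}q mf _ IH]; first by under eq_fun do rewrite mulr0; exact: pol0.
under eq_fun do rewrite mulrDr mulrCA.
apply: (pol_add (fun z => _) (fun z => _)) => //.
by apply: (pol_scale _ (fun z => _)); exact: pol_mul_mon.
Qed.

End Monomials.

(** * Polarization identities *)

Section Polarization.
Context {F : numFieldType}.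
Implicit Types u x a b i : F.

Lemma polarization u x :
  0 + 4^-1 * ((1 * u + 1 * x) * (1 * u + 1 * x))
  + - 4^-1 * ((1 * u + - 1 * x) * (1 * u + - 1 * x)) = u * x.
Proof. by field. Qed.

(** Here [a] and [b] stand for the conjugates of [u] and [x]. The unsimplified left side is the
    expression that four additions to an empty scratch cell produce. *)
Lemma polarization_conj u x a b i : i * i = - 1 ->
  0 + 4^-1 * ((1 * u + 1 * x) * (a + 1 * b))
  + - 4^-1 * ((1 * u + - 1 * x) * (a + - 1 * b))
  + - i * 4^-1 * ((1 * u + i * x) * (a + - i * b))
  + i * 4^-1 * ((1 * u + - i * x) * (a + - - i * b)) = a * x.
Proof.
move=> i2.
transitivity ((2 * u * b + 2 * a * x + 2 * (i * i) * (u * b - a * x)) / 4); first by field.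
by rewrite i2; field.
Qed.

End Polarization.

(** * Evaluating polynomials in the registers *)

Section Program.
Context {R : realType} (rho : R[i] -> R[i]) (n m W : nat) (K : set 'rV[R[i]]_n).

Let k := ((n + m) + (1 + 1))%N.
Context (approx_aff : forall (P : 'M[R[i]]_(n, k)) p, approx rho n W K (affmap P p)).
Context (steps_conj : steps rho n W K k conjc).
Context (steps_quad : has_quadratic (steps rho n W K k)).

(* Registers: the input [z], the accumulated output [y], a monomial [w] and a scratch cell [t]. *)
Definition state (z : 'rV[R[i]]_n) (y : 'rV[R[i]]_m) (w t : R[i]) : 'rV[R[i]]_k :=
  row_mx (row_mx z y) (row_mx w%:M t%:M).

Definition reach (y : 'rV[R[i]]_n -> 'rV[R[i]]_m) (w t : 'rV[R[i]]_n -> R[i]) :=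
  approx rho n W K (fun z => state z (y z) (w z) (t z)).

Lemma reach_ext y w t w' : reach y w t -> w =1 w' -> reach y w' t.
Proof. by move=> H /funext <-. Qed.

Lemma reach_step phi y w t (v : 'M[R[i]]_(n, 1)) (al l : R[i]) :
  steps rho n W K k phi -> reach y w t ->
  reach y w (fun z => t z + l * phi (al * w z + (z *m v) 0 0)).
Proof.
move=> Sphi H.
pose a : 'M[R[i]]_(k, 1) := col_mx (col_mx v 0) (col_mx al%:M 0).
pose c : 'rV[R[i]]_k := row_mx 0 (row_mx 0 l%:M).
(* The form [a] reads only the input and the monomial register; [c] writes only to the scratch
   cell. *)
have ca : c *m a = 0.
  by rewrite /c /a !mul_row_col !mul0mx !mulmx0 !addr0.
have := Sphi a 0 c _ ca H; congr approx; apply/funext => z.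
rewrite /state /a !mul_row_col !mulmx0 !addr0 -scalar_mxM.
rewrite mxE [X in phi (_ + X)]mxE eqxx mulr1n [X in phi X]addrC [w z * al]mulrC /c.
rewrite !scale_row_mx !scaler0 !add_row_mx !addr0 scale_scalar_mx -raddfD /=.
by rewrite [phi _ * l]mulrC.
Qed.

Lemma reach_step_coord phi y w t i (al be l : R[i]) :
  steps rho n W K k phi -> reach y w t ->
  reach y w (fun z => t z + l * phi (al * w z + be * z 0 i)).
Proof.
move=> Sphi H.
have zE (z : 'rV[R[i]]_n) : (z *m (be *: delta_mx i 0 : 'cV[R[i]]_n)) 0 0 = be * z 0 i.
  by rewrite -scalemxAr -colE !mxE.
have := reach_step _ _ _ _ (be *: delta_mx i 0) al l Sphi H.
by under eq_fun => z do rewrite (zE z).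
Qed.

(** Copying and clearing registers is linear, hence absorbed by the output map of the network
    without a new layer. *)
Lemma reach_move y w t : reach y w t -> reach y t (fun=> 0).
Proof.
move=> H; pose B : 'M[R[i]]_k := block_mx 1%:M 0 0 (col_mx 0 (row_mx 1%:M 0)).
have := approx_affine _ _ _ _ _ _ _ B 0 H; congr approx; apply/funext => z.
rewrite /state /affmap addr0 /B mul_row_block !mulmx0 mulmx1 addr0 add0r mul_row_col.
by rewrite mulmx0 add0r mul_mx_row mulmx1 mulmx0 raddf0.
Qed.

Lemma reach_add_output y w (c : 'rV_m) :
  reach y w (fun=> 0) -> reach (fun z => y z + w z *: c) (fun=> 0) (fun=> 0).
Proof.
move=> H; pose B : 'M[R[i]]_k := block_mx 1%:M 0 (col_mx (row_mx 0 c) 0) 0.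
have := approx_affine _ _ _ _ _ _ _ B 0 H; congr approx; apply/funext => z.
rewrite /state /affmap addr0 /B mul_row_block !mulmx0 mulmx1 addr0 mul_row_col.
rewrite mulmx0 addr0 mul_mx_row mulmx0 mul_scalar_mx add_row_mx addr0.
by rewrite raddf0 row_mx0.
Qed.

Lemma reach_one y : reach y (fun=> 0) (fun=> 0) -> reach y (fun=> 1) (fun=> 0).
Proof.
move=> H.
have := approx_affine _ _ _ _ _ _ _ 1%:M (row_mx 0 (row_mx 1%:M 0) : 'rV_k) H.
congr approx; apply/funext => z.
by rewrite /state /affmap mulmx1 !add_row_mx !addr0 raddf0 add0r.
Qed.

Lemma reach_conj y w : reach y w (fun=> 0) -> reach y (fun z => (w z)^*%C) (fun=> 0).
Proof.
move=> H; have := reach_step _ _ _ _ 0 1 1 steps_conj H.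
under eq_fun do rewrite mulmx0 mxE addr0 !mul1r add0r.
exact: reach_move.
Qed.

(* In each case a polarization identity for the available quadratic form. *)
Lemma reach_mul y w i : reach y w (fun=> 0) -> reach y (fun z => w z * z 0 i) (fun=> 0).
Proof.
have i2 : 'i%R * 'i%R = -1 :> R[i] by rewrite -expr2 sqrCi.
case: steps_quad => S H.
- have := reach_step_coord _ _ _ _ i 1 1 (4^-1) S H.
  move=> /(reach_step_coord _ _ _ _ i 1 (- 1) (- 4^-1) S) /reach_move H'.
  refine (reach_ext _ _ _ _ H' _) => z.
  by rewrite polarization.
(* The form [z * conj z] polarizes to [conj u * x], so the monomial is conjugated beforehand. In the
   last case the result is the conjugate of the product and is conjugated afterwards. *)
- have {}H := reach_conj _ _ H.
  have := reach_step_coord _ _ _ _ i 1 1 (4^-1) S H.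
  move=> /(reach_step_coord _ _ _ _ i 1 (- 1) (- 4^-1) S).
  move=> /(reach_step_coord _ _ _ _ i 1 ('i%R) (- 'i%R * 4^-1) S).
  move=> /(reach_step_coord _ _ _ _ i 1 (- 'i%R) ('i%R * 4^-1) S) /reach_move H'.
  refine (reach_ext _ _ _ _ H' _) => z.
  have cE (b x u : R[i]) : (1 * u + b * x)^*%C = u^*%C + b^*%C * x^*%C.
    by rewrite mul1r conjcD conjcM.
  rewrite !cE !(conjcN 1) (conjcN 'i%R) conjci conjc1 conjcK.
  by apply: polarization_conj.
- have := reach_step_coord _ _ _ _ i 1 1 (4^-1) S H.
  move=> /(reach_step_coord _ _ _ _ i 1 (- 1) (- 4^-1) S) /reach_move /reach_conj H'.
  refine (reach_ext _ _ _ _ H' _) => z.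
  rewrite !mul1r !mulN1r.
  by rewrite add0r !(conjcD, conjcM, conjcN, conjcK, conjc_inv, conjc_nat); field.
Qed.

Lemma reach_mon f y : mon f -> reach y (fun=> 0) (fun=> 0) -> reach y f (fun=> 0).
Proof.
move=> mf H; elim: mf => [|g _|i g _]; [exact: reach_one|exact: reach_conj|exact: reach_mul].
Qed.

Lemma reach_pol p (c : 'rV_m) y : pol p -> reach y (fun=> 0) (fun=> 0) ->
  reach (fun z => y z + p z *: c) (fun=> 0) (fun=> 0).
Proof.
move=> pp; elim: pp y => [|d f {}p mf _ IH] y H.
  by under eq_fun do rewrite scale0r addr0.
under eq_fun do rewrite scalerDl mulrC -scalerA addrA.
by apply: (IH (fun z => _)); apply: reach_add_output; exact: reach_mon.
Qed.

Lemma approx_pol (p : 'I_m -> 'rV[R[i]]_n -> R[i]) : (forall j, pol (p j)) ->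
  approx rho n W K (fun z => \row_j p j z).
Proof.
move=> pp.
have H (r : seq 'I_m) :
    reach (fun z => \sum_(j <- r) p j z *: delta_mx 0 j) (fun=> 0) (fun=> 0).
  elim: r => [|j r IH]; last first.
    by under eq_fun do rewrite big_cons addrC; exact: reach_pol.
  under eq_fun do rewrite big_nil.
  have := approx_aff (row_mx (row_mx 1%:M 0) 0) 0; congr approx; apply/funext => z.
  by rewrite /affmap addr0 !mul_mx_row mulmx1 !mulmx0 /state raddf0 row_mx0.
have := approx_affine _ _ _ _ _ _ _ (col_mx (col_mx 0 1%:M) 0) 0 (H (index_enum _)).
congr approx; apply/funext => z.
rewrite /affmap addr0 /state !mul_row_col !mulmx0 mulmx1 addr0 add0r.
by rewrite [RHS]row_sum_delta; apply: eq_bigr => j _; rewrite mxE.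
Qed.

End Program.

(** * Universality *)

Section ReIm.
Context {R : realType} {T : topologicalType} (f : T -> R[i]) (fc : continuous f).

Lemma continuous_Re : continuous (fun z => complex.Re (f z) : R).
Proof.
move=> z; apply/(@cvgrPdist_lt _ _ _ (nbhs z)) => e e0.
have /(@cvg_ncP _ _ (nbhs z))/(_ e e0) := fc z; apply: filterS => w; apply: le_lt_trans.
by rewrite (le_trans _ (Re_le_nc _))//; case: (f z) (f w) => [a b] [c d].
Qed.

Lemma continuous_Im : continuous (fun z => complex.Im (f z) : R).
Proof.
move=> z; apply/(@cvgrPdist_lt _ _ _ (nbhs z)) => e e0.
have /(@cvg_ncP _ _ (nbhs z))/(_ e e0) := fc z; apply: filterS => w; apply: le_lt_trans.
by rewrite (le_trans _ (Im_le_nc _))//; case: (f z) (f w) => [a b] [c d].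
Qed.

End ReIm.

Lemma continuous_add (R : realType) (T : topologicalType) (g h : T -> R) :
  continuous g -> continuous h -> continuous (fun z => g z + h z).
Proof. by move=> gc hc z; apply: cvgD; [exact: gc|exact: hc]. Qed.

Lemma continuous_mul (R : realType) (T : topologicalType) (g h : T -> R) :
  continuous g -> continuous h -> continuous (fun z => g z * h z).
Proof. by move=> gc hc z; apply: cvgM; [exact: gc|exact: hc]. Qed.

(** * Density of the polynomials on a compact set *)

Section Density.

Context {R : realType} {n : nat} (K : set 'rV[R[i]]_n) (cK : compact K).

Lemma compact_rn_bounded : exists M : R, forall z, K z -> rn z <= M.
Proof.
have H j : exists M : R, forall z, K z -> nc (z 0 j) <= M.
  have cj : continuous (fun z : 'rV[R[i]]_n => z 0 j) by exact: coord_continuous.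
  have [M _ MP] := continuous_bounded _ cK _ (continuous_Re _ cj).
  have [N _ NP] := continuous_bounded _ cK _ (continuous_Im _ cj).
  exists (M + N) => z Kz; rewrite (le_trans (nc_le_ReIm _))// lerD ?MP ?NP//.
have [M MP] := choice H.
by exists (\sum_j M j) => z Kz; apply: ler_sum => j _; exact: MP.
Qed.

(** The Stone-Weierstrass theorem above is about real functions, whereas [pol] is complex: this is
    the real algebra to which it is applied. *)
Definition real_pol_limit (f : 'rV[R[i]]_n -> R) := continuous f /\
  forall e : R, 0 < e -> exists2 p, pol p & forall z, K z -> nc (p z - (f z)%:C) <= e.

Lemma monX1 i : mon (fun z : 'rV[R[i]]_n => z 0 i).
Proof. by have := monX i _ (@mon1 R n); under eq_fun do rewrite mul1r. Qed.

Lemma real_pol_limit_all f : continuous f -> real_pol_limit f.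
Proof.
apply: (@Stone_Weierstrass R _ K real_pol_limit cK).
- by move=> g [].
- move=> c; split; first exact: cst_continuous.
  move=> e e0; exists (fun=> c%:C * 1); first by apply: (pol_mon _ (fun=> 1)); exact: mon1.
  by move=> z _; rewrite mulr1 subrr nc0 ltW.
- move=> g h [gc gP] [hc hP]; split; first exact: continuous_add.
  move=> e e0; have e20 : 0 < e / 2 by lra.
  have [p pp pg] := gP _ e20; have [q pq qh] := hP _ e20.
  exists (fun z => p z + q z); first exact: pol_add.
  move=> z Kz; rewrite rmorphD opprD addrACA (le_trans (ncD _ _))//.
  by rewrite [e]splitr lerD ?pg ?qh.
- move=> g h [gc gP] [hc hP]; split; first exact: continuous_mul.
  move=> e e0.
  have [M M0 MP] := continuous_bounded _ cK _ gc.
  have [N N0 NP] := continuous_bounded _ cK _ hc.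
  have MN0 : 0 < 1 + M + N by lra.
  (* The error of the product is at most [d * d + M * d + N * d], and [d <= 1] reduces [d * d] to
     [d]. *)
  pose d := Num.min 1 (e / (1 + M + N)).
  have d0 : 0 < d by rewrite lt_min ltr01 divr_gt0.
  have [p pp pg] := gP _ d0; have [q pq qh] := hP _ d0.
  exists (fun z => p z * q z); first exact: pol_mul.
  move=> z Kz; rewrite rmorphM /=.
  set P := p z; set Q := q z; set G := (g z)%:C; set H := (h z)%:C.
  rewrite (_ : _ - _ = (P - G) * (Q - H) + G * (Q - H) + H * (P - G)); last by ring.
  rewrite (le_trans (ncD _ _))// (le_trans (lerD (ncD _ _) (lexx _)))// !ncM.
  have p1 : nc (P - G) <= d by exact: pg.
  have q1 : nc (Q - H) <= d by exact: qh.
  have g1 : nc G <= M by rewrite ncR MP.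
  have h1 : nc H <= N by rewrite ncR NP.
  apply: (@le_trans _ _ (1 * d + M * d + N * d)).
    by rewrite !lerD// ler_pM ?nc_ge0// (le_trans p1)// ge_min lexx.
  rewrite -!mulrDl -ler_pdivlMl// mulrC.
  by rewrite /d ge_min lexx orbT.
- move=> x y xy.
  have [i xyi] : exists i, x 0 i <> y 0 i.
    apply: contrapT => nxy; apply: xy; apply/rowP => i.
    by apply: contrapT => xyi; apply: nxy; exists i.
  have ci : continuous (fun z : 'rV[R[i]]_n => z 0 i) by exact: coord_continuous.
  have [rexy|rexy] := eqVneq (complex.Re (x 0 i)) (complex.Re (y 0 i)).
    exists (fun z : 'rV[R[i]]_n => complex.Im (z 0 i)).
      split; first exact: continuous_Im.
      move=> e e0; exists (fun z : 'rV[R[i]]_n => ('i%R / 2) * (z 0 i)^*%C + (- 'i%R / 2) * z 0 i).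
        apply: polD; first by apply: monJ; exact: monX1.
        by apply: pol_mon; exact: monX1.
      move=> z _; rewrite ImJ_sub complexiE (_ : _ - _ = 0) ?nc0 ?ltW//.
      by field.
    by move=> imxy; apply: xyi; apply/eqP; rewrite eq_complex rexy imxy !eqxx.
  exists (fun z : 'rV[R[i]]_n => complex.Re (z 0 i)); last by apply/eqP.
  split; first exact: continuous_Re.
  move=> e e0; exists (fun z : 'rV[R[i]]_n => 2^-1 * (z 0 i)^*%C + 2^-1 * z 0 i).
    apply: polD; first by apply: monJ; exact: monX1.
    by apply: pol_mon; exact: monX1.
  move=> z _; rewrite ReJ_add (_ : _ - _ = 0) ?nc0 ?ltW//.
  by field.
- move=> g gc H; split => // e e0; have e20 : 0 < e / 2 by lra.
  have [h [_ hP] hg] := H _ e20; have [p pp ph] := hP _ e20.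
  exists p => // z Kz; rewrite (le_trans (nc_dist (h z)%:C _ _))//.
  by rewrite [e]splitr lerD ?ph// -rmorphB ncR hg.
Qed.

Lemma pol_dense (g : 'rV[R[i]]_n -> R[i]) : continuous g -> forall e : R, 0 < e ->
  exists2 p, pol p & forall z, K z -> nc (p z - g z) < e.
Proof.
move=> gc e e0; have e40 : 0 < e / 4 by lra.
have [_ /(_ _ e40)[p pp pP]] := real_pol_limit_all _ (continuous_Re _ gc).
have [_ /(_ _ e40)[q pq qP]] := real_pol_limit_all _ (continuous_Im _ gc).
exists (fun z => p z + 'i%R * q z); first by apply: pol_add => //; exact: pol_scale.
move=> z Kz; rewrite [g z]complexE complexiE opprD addrACA -mulrBr.
rewrite (le_lt_trans (ncD _ _))// ncM nci mul1r.
by have := pP z Kz; have := qP z Kz; lra.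
Qed.

End Density.

Section Universality.
Context {R : realType} (rho : R[i] -> R[i]) (rhoc : continuous rho).
Context (n m : nat).
Let k := ((n + m) + (1 + 1))%N.

Lemma universal_of_steps W :
  (forall K : set 'rV[R[i]]_n, (exists M : R, forall z, K z -> rn z <= M) ->
    [/\ forall (P : 'M[R[i]]_(n, k)) p, approx rho n W K (affmap P p),
        steps rho n W K k conjc & has_quadratic (steps rho n W K k)]) ->
  universal (NN rho n m W).
Proof.
move=> H g gc K cK eps eps0; have [aff cj qd] := H K (compact_rn_bounded K cK).
have e20 : 0 < eps / 2 by lra.
have em : 0 < eps / 2 / m.+1%:R by rewrite divr_gt0// ltr0n.
have gj j : exists p, pol p /\ forall z, K z -> nc (p z - g z 0 j) < eps / 2 / m.+1%:R.
  have [|p pp pg] := pol_dense K cK (fun z => g z 0 j) _ _ em; last by exists p.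
  move=> z; apply: (@continuous_comp _ _ _ g (fun M : 'rV[R[i]]_m => M 0 j)); first exact: gc.
  exact: coord_continuous.
have [p pP] := choice gj.
have [|f Nf fp] := approx_pol rho n m W K aff cj qd p _ _ e20.
  by move=> j; have [] := pP j.
exists f => // z Kz.
have fg : rn (f z - g z) < eps.
  rewrite (le_lt_trans (rn_dist _ (\row_j p j z) _ _))// [eps]splitr ltrD ?fp//.
  by apply: rn_small => // j; rewrite !mxE; have [_] := pP j; apply.
(* A nonzero norm is attained at some entry, which [rn] dominates. *)
have [->|x0] := eqVneq `|f z - g z| 0; first by rewrite ltcR.
have [i iE] := mx_norm_neq0 x0.
rewrite -[X in X < _]/(mx_norm (f z - g z)) iE normr_nc ltcR.
by rewrite (le_lt_trans _ fg)// ord1 nc_le_rn.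
Qed.

Context (rho2 : C2 rho) (nh : ~ holomorphic rho) (na : ~ antiholomorphic rho).
Context (nr : ~ R_affine rho).

(** The assumed block puts [rho] itself into [steps]; with [a], [b] and [c] zero it is an identity
    layer, which loads the registers. *)
Lemma universal_of_id W :
  (forall (a : 'M[R[i]]_(k, 1)) b (c : 'rV_k),
    block_approx rho W (fun s => s + rho ((s *m a) 0 0 + b) *: c)) ->
  universal (NN rho n m W).
Proof.
move=> H; apply: universal_of_steps => K [M KM].
have Srho : steps rho n W K k rho.
  by move=> a b c F _ aF; exact: (approx_comp _ rhoc _ _ _ _ KM _ _ _ _ aF (H a b c)).
have [_ cj qd] := class_generators _ _ (steps_closed rho rhoc n W K M KM k) rho2 nh na nr Srho.
split; [move=> P p|exact: cj|exact: qd].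
have := approx_block_affine _ _ _ _ _ KM _ _ P p _ (H 0 0 0).
by under eq_fun do rewrite scaler0 addr0.
Qed.

Lemma map_mx_conjcK l (s : 'rV[R[i]]_l) : map_mx conjc (map_mx conjc s) = s.
Proof. by apply/rowP => j; rewrite !mxE conjcK. Qed.

Lemma map_mx_conjcD l (s t : 'rV[R[i]]_l) :
  map_mx conjc (s + t) = map_mx conjc s + map_mx conjc t.
Proof. by apply/rowP => j; rewrite !mxE conjcD. Qed.

Lemma map_mx_conjcZ l c (s : 'rV[R[i]]_l) :
  map_mx conjc (c *: s) = c^*%C *: map_mx conjc s.
Proof. by apply/rowP => j; rewrite !mxE conjcM. Qed.

(* Two layers restore the registers and add a conjugated neuron, so that the
   activation is effectively [conj rho]. *)
Lemma universal_of_conj W :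
  (forall (a : 'M[R[i]]_(k, 1)) b (c : 'rV_k),
    block_approx rho W (fun s => map_mx conjc s + rho ((s *m a) 0 0 + b) *: c)) ->
  universal (NN rho n m W).
Proof.
move=> H; apply: universal_of_steps => K [M KM].
have H0 : block_approx rho W (fun s : 'rV[R[i]]_k => map_mx conjc s).
  by have := H 0 0 0; under eq_fun do rewrite scaler0 addr0.
have [cD cZ cA cL] := steps_closed rho rhoc n W K M KM k.
(* A pair of layers adds [conj rho], so the generators are extracted in the conjugated class:
   [Phi id] is the conjugation in [steps], and the two pure squares trade places. *)
pose Phi : set (R[i] -> R[i]) := fun phi => steps rho n W K k (fun z => (phi z)^*%C).
have Phi_closed : closed_class Phi.
  split.
  - move=> f g Pf Pg; have := cD _ _ Pf Pg; rewrite /Phi.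
    by under [X in _ -> steps _ _ _ _ _ X]eq_fun do rewrite conjcD.
  - move=> c f Pf; have := cZ c^*%C _ Pf; rewrite /Phi.
    by under [X in _ -> steps _ _ _ _ _ X]eq_fun do rewrite conjcM.
  - by move=> a b f Pf; have := cA a b _ Pf.
  - move=> f Pf; apply: cL => N e e0; have [g Pg gf] := Pf N e e0.
    exists (fun z => (g z)^*%C); first exact: Pg.
    by move=> z /gf; rewrite -ncJ conjcB.
have Prho : Phi rho.
  move=> a b c F _ aF.
  have := approx_comp _ rhoc _ _ _ _ KM _ _ _ _
    (approx_comp _ rhoc _ _ _ _ KM _ _ _ _ aF (H a b (map_mx conjc c))) H0.
  by under eq_fun do rewrite map_mx_conjcD map_mx_conjcZ !map_mx_conjcK.
have [cj _ qd] := class_generators _ _ Phi_closed rho2 nh na nr Prho.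
split; [move=> P p|exact: cj|].
- have := approx_comp _ rhoc _ _ _ _ KM _ _ _ _
    (approx_block_affine _ _ _ _ _ KM _ _ P p _ H0) H0.
  by under eq_fun do rewrite map_mx_conjcK.
- case: qd => S.
  + by constructor 3; have := S; rewrite /Phi; under eq_fun do rewrite conjcM.
  + by constructor 2; have := S; rewrite /Phi; under eq_fun do rewrite conjcM conjcK mulrC.
  + by constructor 1; have := S; rewrite /Phi; under eq_fun do rewrite conjcM conjcK.
Qed.

End Universality.

Section IdentityBlocks.
Context {R : realType} (rho rx ry : R[i] -> R[i]) (rc : c1 rho rx ry) (z : R[i]) (k : nat).

(* [rho (z + h s)] and [rho (z + 'i h s)] together recover [s] to first order. *)
Lemma block_approx_id2 : wirt (rx z) (ry z) != 0 ->
  block_approx rho (k + k) (fun s : 'rV[R[i]]_k => s).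
Proof.
move=> a0; set a := wirt _ _ in a0.
have i2 : 'i%R * 'i%R = -1 :> R[i] by rewrite -expr2 sqrCi.
have L := block_approx_rlin rho k _ _ z rc.
have := block_approxD rho _ _ _ _ _ _ (block_approx_post rho _ _ _ _ _ ((2 * a)^-1)%:M L)
  (block_approx_post rho _ _ _ _ _ (- 'i%R / (2 * a))%:M (block_approx_pre rho _ _ _ _ _ ('i%R)%:M L)).
congr block_approx; apply/funext => s; apply/rowP => j.
rewrite !mul_mx_scalar !mxE !rlinE conjcM conjci -/a.
set b := wirt_bar _ _; set x := s 0 j; set y := x^*%C.
transitivity ((a * x + b * y - 'i%R * 'i%R * (a * x - b * y)) / (2 * a)); first by field.
by rewrite i2; field.
Qed.

(** The differential is already C-linear, so no second neuron is needed to cancel an antilinear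
    part. *)
Lemma block_approx_id1 : wirt (rx z) (ry z) != 0 -> wirt_bar (rx z) (ry z) = 0 ->
  block_approx rho k (fun s : 'rV[R[i]]_k => s).
Proof.
move=> a0 b0; have := block_approx_post rho _ _ _ _ _ ((wirt (rx z) (ry z))^-1)%:M
  (block_approx_rlin rho k _ _ z rc).
congr block_approx; apply/funext => s; apply/rowP => j.
by rewrite mul_mx_scalar !mxE rlinE b0 mul0r addr0 mulKf.
Qed.

Lemma block_approx_conj1 : wirt (rx z) (ry z) = 0 -> wirt_bar (rx z) (ry z) != 0 ->
  block_approx rho k (fun s : 'rV[R[i]]_k => map_mx conjc s).
Proof.
move=> a0 b0; have := block_approx_post rho _ _ _ _ _ ((wirt_bar (rx z) (ry z))^-1)%:M
  (block_approx_rlin rho k _ _ z rc).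
congr block_approx; apply/funext => s; apply/rowP => j.
by rewrite mul_mx_scalar !mxE rlinE a0 mul0r add0r mulKf.
Qed.

End IdentityBlocks.

Theorem theorem5p3 (R : realType) (n m : nat) (rho : R[i] -> R[i]) :
  C2 rho -> ~ holomorphic rho -> ~ antiholomorphic rho -> ~ R_affine rho ->
  universal (NN rho n m (2 * n + 2 * m + 5)) /\
  ((exists (z0 dx dy : R[i]),
      has_partial_x rho z0 dx /\ has_partial_y rho z0 dy /\
      ((wirt dx dy != 0 /\ wirt_bar dx dy = 0) \/
       (wirt dx dy = 0 /\ wirt_bar dx dy != 0))) ->
   universal (NN rho n m (n + m + 4))).
Proof.
move=> rho2 nh na nr.
have rhoc : continuous rho by case: rho2 => ? [? [? [? [? [? [rhoc _]]]]]]; exact: rhoc.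
have [rx [ry [_ [_ [_ [_ [rc _ _]]]]]]] := C2_c1 _ rho2.
split.
  have [z wz] : exists z, wirt (rx z) (ry z) != 0.
    apply: contrapT => H; apply: na; apply: (antiholomorphic_wirt0 _ _ _ rc) => z.
    by apply/eqP; apply: contrapT => /negP wz; apply: H; exists z.
  pose k := ((n + m) + (1 + 1))%N.
  have -> : (2 * n + 2 * m + 5 = (k + k) + 1)%N by rewrite /k; lia.
  apply: (universal_of_id rho rhoc n m rho2 nh na nr) => a b c.
  apply: block_approxD; last exact: block_approx_neuron.
  exact: (block_approx_id2 rho rx ry rc z).
move=> [z0 [dx [dy [px [py H]]]]].
have [qx qy _ _] := rc.
have dxE := has_partial_unique _ _ _ px (qx z0).
have dyE := has_partial_unique _ _ _ py (qy z0).
rewrite dxE dyE in H.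
pose k := ((n + m) + (1 + 1))%N.
have -> : (n + m + 4 = (k + 1) + 1)%N by rewrite /k; lia.
(* The construction takes [k + 1 = n + m + 3] neurons; a neuron with output weight 0 fills the
   stated width. *)
have pad (G : 'rV[R[i]]_k -> 'rV[R[i]]_k) : block_approx rho k G ->
    block_approx rho (k + 1) G.
  move=> bG; have := block_approxD rho _ _ _ _ _ _ bG (block_approx_neuron rho _ _ 0 0 0).
  by under eq_fun do rewrite scaler0 addr0.
case: H => -[w1 w2].
  apply: (universal_of_id rho rhoc n m rho2 nh na nr) => a b c.
  apply: block_approxD; last exact: block_approx_neuron.
  exact/pad/(block_approx_id1 rho rx ry rc z0).
apply: (universal_of_conj rho rhoc n m rho2 nh na nr) => a b c.
apply: block_approxD; last exact: block_approx_neuron.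
exact/pad/(block_approx_conj1 rho rx ry rc z0).
Qed.
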